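(* For each infinite cardinal $\kappa$, the structure $\mathcal{M}_\kappa$ described in the context is a model of the equational theory ACP$^\epsilon_c$ described in the context, i.e. every axiom of ACP$^\epsilon_c$ holds in $\mathcal{M}_\kappa$ for all interpretations of its variables.
   Context: Fixed data: a finite set $\mathsf{A}$ of actions, constants $\delta,\epsilon\notin\mathsf{A}$, $\mathsf{A}_\delta=\mathsf{A}\cup\{\delta\}$, a commutative and associative communication function $|:\mathsf{A}_\delta\times\mathsf{A}_\delta\to\mathsf{A}_\delta$ with $\delta|a=\delta$; a set $\mathsf{C}$ of atomic conditions. For an infinite cardinal $\kappa$, $\mathbb{B}_\kappa$ is the free $\kappa$-complete Boolean algebra over $\mathsf{C}$, $\mathbb{B}_\kappa^-=\mathbb{B}_\kappa\setminus\{\bot\}$, $\alpha\sqsubseteq\beta$ iff $\alpha\sqcup\beta=\beta$, $\bigsqcup C$ the supremum of $C$ (of cardinality $<\kappa$). The theory ACP$^\epsilon_c$ has sorts Proc and Cond; Proc-terms are built from constants $\delta,\epsilon$, $a\in\mathsf{A}$, and operators $+,\cdot,\parallel,\lfloor\!\lfloor,|$ (binary on Proc), $\phi:\to x$ (Cond $\times$ Proc $\to$ Proc), $\partial_H$ ($H\subseteq\mathsf{A}$); Cond-terms from $\bot,\top$, $\eta\in\mathsf{C}$, $-,\sqcup,\sqcap$. Its axioms (with $a,b,c$ ranging over $\mathsf{A}_\delta$, i.e. over constants other than $\epsilon$, and $H\subseteq\mathsf{A}$) are: A1 $x+y=y+x$; A2 $(x+y)+z=x+(y+z)$; A3 $x+x=x$;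 A4 $(x+y)\cdot z=x\cdot z+y\cdot z$; A5 $(x\cdot y)\cdot z=x\cdot(y\cdot z)$; A6 $x+\delta=x$; A7 $\delta\cdot x=\delta$; A8 $x\cdot\epsilon=x$; A9 $\epsilon\cdot x=x$; CM1T $x\parallel y=x\lfloor\!\lfloor y+y\lfloor\!\lfloor x+x|y+\partial_{\mathsf{A}}(x)\cdot\partial_{\mathsf{A}}(y)$; TM2 $\epsilon\lfloor\!\lfloor x=\delta$; CM3 $a\cdot x\lfloor\!\lfloor y=a\cdot(x\parallel y)$; CM4 $(x+y)\lfloor\!\lfloor z=x\lfloor\!\lfloor z+y\lfloor\!\lfloor z$; TM5 $\epsilon|x=\delta$; TM6 $x|\epsilon=\delta$; CM7 $a\cdot x|b\cdot y=(a|b)\cdot(x\parallel y)$; CM8 $(x+y)|z=x|z+y|z$; CM9 $x|(y+z)=x|y+x|z$; C1 $a|b=b|a$; C2 $(a|b)|c=a|(b|c)$; C3 $\delta|a=\delta$; D0 $\partial_H(\epsilon)=\epsilon$; D1 $\partial_H(a)=a$ if $a\notin H$; D2 $\partial_H(a)=\delta$ if $a\in H$; D3 $\partial_H(x+y)=\partial_H(x)+\partial_H(y)$; D4 $\partial_H(x\cdot y)=\partial_H(x)\cdot\partial_H(y)$; GC1 $\top:\to x=x$; GC2 $\bot:\to x=\delta$; GC3 $\phi:\to\delta=\delta$; GC4 $\phi:\to(x+y)=\phi:\to x+\phi:\to y$; GC5 $\phi:\to x\cdot y=(\phi:\to x)\cdot y$; GC6 $\phi:\to(\psi:\to x)=(\phi\sqcap\psi):\to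 x$; GC7 $(\phi\sqcup\psi):\to x=\phi:\to x+\psi:\to x$; GC8 $(\phi:\to x)\lfloor\!\lfloor y=\phi:\to(x\lfloor\!\lfloor y)$; GC9 $(\phi:\to x)|y=\phi:\to(x|y)$; GC10 $x|(\phi:\to y)=\phi:\to(x|y)$; GC11 $\partial_H(\phi:\to x)=\phi:\to\partial_H(x)$; BA1 $\phi\sqcup\bot=\phi$; BA2 $\phi\sqcup-\phi=\top$; BA3 $\phi\sqcup\psi=\psi\sqcup\phi$; BA4 $\phi\sqcup(\psi\sqcap\chi)=(\phi\sqcup\psi)\sqcap(\phi\sqcup\chi)$; BA5 $\phi\sqcap\top=\phi$; BA6 $\phi\sqcap-\phi=\bot$; BA7 $\phi\sqcap\psi=\psi\sqcap\phi$; BA8 $\phi\sqcap(\psi\sqcup\chi)=(\phi\sqcap\psi)\sqcup(\phi\sqcap\chi)$. (Here $\phi:\to x$ is the guarded command; operator precedence: $\cdot$ binds strongest, $+$ weakest.) Transition systems: a $\kappa$-conditional transition system is $T=(S,\to,\downarrow,s^0)$ with relations $\xrightarrow{[\alpha]a}\subseteq S\times S$ for $(\alpha,a)\in\mathbb{B}_\kappa^-\times\mathsf{A}$, sets $\downarrow_\alpha\subseteq S$ for $\alpha\in\mathbb{B}_\kappa^-$, and initial state $s^0$. $\mathrm{conn}(T)$ restricts $T$ to states reachable from $s^0$. A fixed set $\mathcal{S}_\kappa$ of cardinality $\ge\kappa$ is closed under disjoint union $S_1\uplus S_2$ (injections $\iota_1,\iota_2$) and product of subsets; $\mathrm{ch}$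 is a fixed choice function on nonempty subsets of $\mathcal{S}_\kappa$. $\mathcal{T}_\kappa$ is the set of connected such systems with $S\subset\mathcal{S}_\kappa$ and branching degree $<\kappa$. Elements and operations on $\mathcal{T}_\kappa$ (relations not mentioned are empty; $T_i=(S_i,\to_i,\downarrow^i,s_i^0)$): $\hat\delta=(\{s^0\},\emptyset,\emptyset,s^0)$ and $\hat\epsilon=(\{s^0\},\emptyset,\downarrow,s^0)$ with $\downarrow_\top=\{s^0\}$, where $s^0=\mathrm{ch}(\mathcal{S}_\kappa)$; $\hat a$ has states $s^0=\mathrm{ch}(\mathcal{S}_\kappa)$, $s^1=\mathrm{ch}(\mathcal{S}_\kappa\setminus\{s^0\})$, the single transition $s^0\xrightarrow{[\top]a}s^1$ and $\downarrow_\top=\{s^1\}$. $T_1\hat+T_2$: new initial state $s^0=\mathrm{ch}(\mathcal{S}_\kappa\setminus(S_1\uplus S_2))$ having the injected initial transitions and termination of both $s_1^0,s_2^0$, plus injected copies of $T_1,T_2$, then conn. $T_1\hat\cdot T_2=\mathrm{conn}(S_1\uplus S_2,\to,\downarrow,\iota_1(s_1^0))$ with transitions: $\iota_1(s)\xrightarrow{[\alpha]a}\iota_1(s')$ if $s\xrightarrow{[\alpha]a}_1s'$ and $s'$ has no termination; $\iota_1(s)\xrightarrow{[\alpha]a}\iota_2(s_2^0)$ if $s\xrightarrow{[\alpha]a}_1s'$ for some $s'$ with $s'\downarrow^1_\beta$ for some $\beta$; $\iota_2(s_2^0)\xrightarrow{[\beta\sqcap\beta']a}\iota_2(s')$ if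 some $s\downarrow^1_\beta$ and $s_2^0\xrightarrow{[\beta']a}_2s'$; $\iota_2(s)\xrightarrow{[\alpha]a}\iota_2(s')$ if $s\xrightarrow{[\alpha]a}_2s'$, $s\ne s_2^0$; termination: $\iota_2(s_2^0)\downarrow_{\beta\sqcap\beta'}$ if some $s\downarrow^1_\beta$ and $s_2^0\downarrow^2_{\beta'}$, and $\iota_2(s)\downarrow_\alpha$ if $s\downarrow^2_\alpha$, $s\ne s_2^0$. $\alpha\hat{:\to}T$: labels $\beta$ of initial transitions and initial terminations replaced by $\alpha\sqcap\beta$ (dropped if $\bot$), everything else unchanged, then conn. $T_1\hat\parallel T_2=(S_1\times S_2,\to,\downarrow,(s_1^0,s_2^0))$ with interleaving transitions of either component, synchronisations $(s_1,s_2)\xrightarrow{[\alpha'\sqcap\beta']a'|b'}(s_1',s_2')$ for $s_1\xrightarrow{[\alpha']a'}_1s_1'$, $s_2\xrightarrow{[\beta']b'}_2s_2'$ with $a'|b'\in\mathsf{A}$ and $\alpha'\sqcap\beta'\ne\bot$, and $(s_1,s_2)\downarrow_{\alpha'\sqcap\beta'}$ if $s_1\downarrow^1_{\alpha'}$, $s_2\downarrow^2_{\beta'}$. $T_1\hat{\lfloor\!\lfloor}T_2$ (resp. $T_1\hat|T_2$): $T_1\hat\parallel T_2=(S,\to,\downarrow,s^0)$ extended with a new initial state $\mathrm{ch}(\mathcal{S}_\kappa\setminus S)$ whose outgoing transitions are those $s_1^0\xrightarrow{[\alpha]a}_1s$ leading to $(s,s_2^0)$ (resp. the synchronisations of initial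 transitions of $s_1^0$ and $s_2^0$ leading to $(s_1,s_2)$), then conn. $\hat\partial_H(T)$ removes all transitions with action in $H$, then conn. Splitting bisimilarity $\leftrightarrow$ on $\mathcal{T}_\kappa$: $T_1\leftrightarrow T_2$ iff there is $B\subseteq S_1\times S_2$ with $B(s_1^0,s_2^0)$ such that whenever $B(s_1,s_2)$: if $s_1\xrightarrow{[\alpha]a}_1s_1'$ there is $CS\subseteq\mathbb{B}_\kappa^-\times S_2$ of cardinality $<\kappa$ with $\alpha\sqsubseteq\bigsqcup\mathrm{dom}(CS)$ and $s_2\xrightarrow{[\alpha']a}_2s_2'$, $B(s_1',s_2')$ for all $(\alpha',s_2')\in CS$; if $s_1\downarrow^1_\alpha$ there is $C'\subseteq\mathbb{B}_\kappa^-$ of cardinality $<\kappa$ with $\alpha\sqsubseteq\bigsqcup C'$ and $s_2\downarrow^2_{\alpha'}$ for all $\alpha'\in C'$; and symmetrically for $s_2$. It is an equivalence and a congruence for the operations above. The structure $\mathcal{M}_\kappa$: sort Proc is interpreted by $\mathcal{T}_\kappa/{\leftrightarrow}$, sort Cond by $\mathbb{B}_\kappa$ (with its Boolean operations and $\eta\in\mathsf{C}$ interpreted as the corresponding generator); $\delta,\epsilon,a$ are interpreted as the classes of $\hat\delta,\hat\epsilon,\hat a$, and each operator $f$ by $f([T_1],[T_2])=[\hat f(T_1,T_2)]$ (similarly for unary operators and $\alpha:\to[T]=[\alpha\hat{:\to}T]$).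
   Formalization: As worded, ε·ε equals δ (A9 fails) and guarding ignores bisimilarity on cycles; so sequential composition enters T2 from each terminating state of T1, which keeps its own transitions; guarding uses a fresh initial state; branching degree also counts terminations. *)

(* Defs.v *)
From HB Require Import structures.
From mathcomp Require Import all_boot all_order generic_quotient.
From mathcomp Require Import boolp classical_sets functions cardinality.
Set Implicit Arguments.
Unset Strict Implicit.
Unset Printing Implicit Defensive.
Local Open Scope classical_set_scope.
Local Open Scope card_scope.

(** The cardinal κ is given as the cardinality of a type [K]. *)
Definition card_lt (K T : Type) (X : set T) : bool :=
  (X #<= [set: K]) && ~~ ([set: K] #<= X).

Record acpc_structure (A : finType) (C : Type) := AcpcStructure {
  Proc : Type;
  Cond : Type;
  delta : Proc;
  eps : Proc;
  act : A -> Proc;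
  alt : Proc -> Proc -> Proc;
  seqc : Proc -> Proc -> Proc;
  par : Proc -> Proc -> Proc;
  lmerge : Proc -> Proc -> Proc;
  cmerge : Proc -> Proc -> Proc;
  guard : Cond -> Proc -> Proc;
  encap : {set A} -> Proc -> Proc;
  cbot : Cond;
  ctop : Cond;
  catom : C -> Cond;
  cneg : Cond -> Cond;
  cjoin : Cond -> Cond -> Cond;
  cmeet : Cond -> Cond -> Cond }.

Declare Scope acpc_scope.
Delimit Scope acpc_scope with acpc.
Notation "x ⋅ y" := (seqc x y) (at level 40, left associativity) : acpc_scope.
Notation "x ∥ y" := (par x y) (at level 45, no associativity) : acpc_scope.
Notation "x ⌊⌊ y" := (lmerge x y) (at level 45, no associativity) : acpc_scope.
Notation "x ∣ y" := (cmerge x y) (at level 45, no associativity) : acpc_scope.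
Notation "φ ':→' x" := (guard φ x) (at level 47, right associativity) : acpc_scope.
Notation "x + y" := (alt x y) : acpc_scope.
Notation "φ ⊔ ψ" := (cjoin φ ψ) (at level 42, left associativity) : acpc_scope.
Notation "φ ⊓ ψ" := (cmeet φ ψ) (at level 42, left associativity) : acpc_scope.

(** [option A] is the set of actions extended with δ, which is [None]. *)
Definition cst (A : finType) (C : Type) (M : acpc_structure A C) (a : option A) :
  Proc M := if a is Some b then act M b else delta M.

Definition in_encap (A : finType) (H : {set A}) (a : option A) : bool :=
  if a is Some b then b \in H else false.

(** In [ax_CM7] and [ax_C1]-[ax_C3], [a | b] is the communication merge of two
    constants. *)
Record acpc_model (A : finType) (C : Type) (M : acpc_structure A C) : Prop := {
  ax_A1 : forall x y : Proc M, (x + y = y + x)%acpc;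
  ax_A2 : forall x y z : Proc M, ((x + y) + z = x + (y + z))%acpc;
  ax_A3 : forall x : Proc M, (x + x = x)%acpc;
  ax_A4 : forall x y z : Proc M, ((x + y) ⋅ z = x ⋅ z + y ⋅ z)%acpc;
  ax_A5 : forall x y z : Proc M, ((x ⋅ y) ⋅ z = x ⋅ (y ⋅ z))%acpc;
  ax_A6 : forall x : Proc M, (x + delta M = x)%acpc;
  ax_A7 : forall x : Proc M, (delta M ⋅ x = delta M)%acpc;
  ax_A8 : forall x : Proc M, (x ⋅ eps M = x)%acpc;
  ax_A9 : forall x : Proc M, (eps M ⋅ x = x)%acpc;
  ax_CM1T : forall x y : Proc M,
    (x ∥ y = x ⌊⌊ y + y ⌊⌊ x + x ∣ y + encap [set: A] x ⋅ encap [set: A] y)%acpc;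
  ax_TM2 : forall x : Proc M, (eps M ⌊⌊ x = delta M)%acpc;
  ax_CM3 : forall (a : option A) (x y : Proc M),
    ((cst M a ⋅ x) ⌊⌊ y = cst M a ⋅ (x ∥ y))%acpc;
  ax_CM4 : forall x y z : Proc M, ((x + y) ⌊⌊ z = x ⌊⌊ z + y ⌊⌊ z)%acpc;
  ax_TM5 : forall x : Proc M, (eps M ∣ x = delta M)%acpc;
  ax_TM6 : forall x : Proc M, (x ∣ eps M = delta M)%acpc;
  ax_CM7 : forall (a b : option A) (x y : Proc M),
    ((cst M a ⋅ x) ∣ (cst M b ⋅ y) = (cst M a ∣ cst M b) ⋅ (x ∥ y))%acpc;
  ax_CM8 : forall x y z : Proc M, ((x + y) ∣ z = x ∣ z + y ∣ z)%acpc;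
  ax_CM9 : forall x y z : Proc M, (x ∣ (y + z) = x ∣ y + x ∣ z)%acpc;
  ax_C1 : forall a b : option A, (cst M a ∣ cst M b = cst M b ∣ cst M a)%acpc;
  ax_C2 : forall a b c : option A,
    ((cst M a ∣ cst M b) ∣ cst M c = cst M a ∣ (cst M b ∣ cst M c))%acpc;
  ax_C3 : forall a : option A, (delta M ∣ cst M a = delta M)%acpc;
  ax_D0 : forall H : {set A}, encap H (eps M) = eps M;
  ax_D1 : forall (H : {set A}) (a : option A), ~~ in_encap H a ->
    encap H (cst M a) = cst M a;
  ax_D2 : forall (H : {set A}) (a : option A), in_encap H a ->
    encap H (cst M a) = delta M;
  ax_D3 : forall (H : {set A}) (x y : Proc M),
    encap H (x + y)%acpc = (encap H x + encap H y)%acpc;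
  ax_D4 : forall (H : {set A}) (x y : Proc M),
    encap H (x ⋅ y)%acpc = (encap H x ⋅ encap H y)%acpc;
  ax_GC1 : forall x : Proc M, (ctop M :→ x = x)%acpc;
  ax_GC2 : forall x : Proc M, (cbot M :→ x = delta M)%acpc;
  ax_GC3 : forall φ : Cond M, (φ :→ delta M = delta M)%acpc;
  ax_GC4 : forall (φ : Cond M) (x y : Proc M),
    (φ :→ (x + y) = (φ :→ x) + (φ :→ y))%acpc;
  ax_GC5 : forall (φ : Cond M) (x y : Proc M),
    (φ :→ (x ⋅ y) = (φ :→ x) ⋅ y)%acpc;
  ax_GC6 : forall (φ ψ : Cond M) (x : Proc M),
    (φ :→ (ψ :→ x) = (φ ⊓ ψ) :→ x)%acpc;
  ax_GC7 : forall (φ ψ : Cond M) (x : Proc M),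
    ((φ ⊔ ψ) :→ x = (φ :→ x) + (ψ :→ x))%acpc;
  ax_GC8 : forall (φ : Cond M) (x y : Proc M),
    ((φ :→ x) ⌊⌊ y = φ :→ (x ⌊⌊ y))%acpc;
  ax_GC9 : forall (φ : Cond M) (x y : Proc M),
    ((φ :→ x) ∣ y = φ :→ (x ∣ y))%acpc;
  ax_GC10 : forall (φ : Cond M) (x y : Proc M),
    (x ∣ (φ :→ y) = φ :→ (x ∣ y))%acpc;
  ax_GC11 : forall (φ : Cond M) (H : {set A}) (x : Proc M),
    encap H (φ :→ x)%acpc = (φ :→ encap H x)%acpc;
  ax_BA1 : forall φ : Cond M, (φ ⊔ cbot M = φ)%acpc;
  ax_BA2 : forall φ : Cond M, (φ ⊔ cneg φ = ctop M)%acpc;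
  ax_BA3 : forall φ ψ : Cond M, (φ ⊔ ψ = ψ ⊔ φ)%acpc;
  ax_BA4 : forall φ ψ χ : Cond M, (φ ⊔ (ψ ⊓ χ) = (φ ⊔ ψ) ⊓ (φ ⊔ χ))%acpc;
  ax_BA5 : forall φ : Cond M, (φ ⊓ ctop M = φ)%acpc;
  ax_BA6 : forall φ : Cond M, (φ ⊓ cneg φ = cbot M)%acpc;
  ax_BA7 : forall φ ψ : Cond M, (φ ⊓ ψ = ψ ⊓ φ)%acpc;
  ax_BA8 : forall φ ψ χ : Cond M, (φ ⊓ (ψ ⊔ χ) = (φ ⊓ ψ) ⊔ (φ ⊓ χ))%acpc }.

Definition kcomplete (K : Type) d (B : ctbDistrLatticeType d) :=
  forall X : set B, card_lt K X -> exists y, supremums X y.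

Definition khom (K : Type) d (B : ctbDistrLatticeType d)
    d' (B' : ctbDistrLatticeType d') (h : B -> B') :=
  (forall x, h (~` x)%O = (~` h x)%O) /\
  (forall (X : set B) y, card_lt K X -> supremums X y -> supremums (h @` X) (h y)).

Definition free_kcomplete (K C : Type) d (B : ctbDistrLatticeType d) (gen : C -> B) :=
  kcomplete K B /\
  forall d' (B' : ctbDistrLatticeType d') (f : C -> B'), kcomplete K B' ->
    exists! h : B -> B', khom K h /\ forall c, h (gen c) = f c.

(** [inL], [inR] and [pr] realise disjoint union and product of subsets inside
    the set of states. *)
Record state_universe (K : Type) := StateUniverse {
  State :> Type;
  card_State : [set: K] #<= [set: State];
  inL : State -> State;
  inR : State -> State;
  inL_inj : injective inL;
  inR_inj : injective inR;
  inLR : forall s t, inL s <> inR t;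
  pr : State -> State -> State;
  pr_inj : forall s t s' t', pr s t = pr s' t' -> s = s' /\ t = t';
  ch : set State -> State;
  chP : forall X : set State, X !=set0 -> X (ch X) }.

Arguments inL {K _}.
Arguments inR {K _}.
Arguments pr {K _}.

Section Systems.
Variables (A : finType) (gamma : option A -> option A -> option A).
Variables (K : Type) (d : Order.disp_t) (B : ctbDistrLatticeType d).
Variable (S : state_universe K).

Record cts := Cts {
  st : set S;
  tr : B -> A -> S -> S -> Prop;
  tm : B -> S -> Prop;
  ini : S }.

Inductive reach (T : cts) : S -> Prop :=
| reach_ini : reach T (ini T)
| reach_tr α a s s' : reach T s -> tr T α a s s' -> reach T s'.

Definition conn (T : cts) : cts := Cts
  (st T `&` reach T)
  (fun α a s s' => [/\ tr T α a s s', reach T s & reach T s'])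
  (fun α s => tm T α s /\ reach T s)
  (ini T).

Definition out (T : cts) (s : S) : set (B * A * S + B) :=
  [set x | match x with
           | inl (α, a, s') => tr T α a s s'
           | inr α => tm T α s
           end].

(** The branching degree counts terminations as well as transitions, and the
    inclusion of the states in [S] is strict, so that [ch] always has a fresh
    state to choose. *)
Record wf (T : cts) : Prop := Wf {
  wf_ini : st T (ini T);
  wf_tr : forall α a s s', tr T α a s s' -> [/\ α <> \bot%O, st T s & st T s'];
  wf_tm : forall α s, tm T α s -> α <> \bot%O /\ st T s;
  wf_proper : st T `<` [set: S];
  wf_branching : forall s, st T s -> card_lt K (out T s) }.

Record Tk := MkTk {
  sys :> cts;
  sys_wf : wf sys;
  sys_conn : st sys `<=` reach sys }.

HB.instance Definition _ := gen_eqMixin Tk.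
HB.instance Definition _ := gen_choiceMixin Tk.

Definition delta_cts : cts :=
  let s0 := ch [set: S] in
  Cts [set s0] (fun _ _ _ _ => False) (fun _ _ => False) s0.

Definition eps_cts : cts :=
  let s0 := ch [set: S] in
  Cts [set s0] (fun _ _ _ _ => False) (fun α s => α = \top%O /\ s = s0) s0.

Definition act_cts (a : A) : cts :=
  let s0 := ch [set: S] in
  let s1 := ch (~` [set s0]) in
  Cts [set s0; s1]
    (fun α b s s' => [/\ α = \top%O, b = a, s = s0 & s' = s1])
    (fun α s => α = \top%O /\ s = s1) s0.

Section Alt.
Variables T1 T2 : cts.
Let S12 : set S := inL @` st T1 `|` inR @` st T2.
Let s0 := ch (~` S12).

Inductive alt_tr : B -> A -> S -> S -> Prop :=
| alt_ini1 α a s' : tr T1 α a (ini T1) s' -> alt_tr α a s0 (inL s')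
| alt_ini2 α a s' : tr T2 α a (ini T2) s' -> alt_tr α a s0 (inR s')
| alt_in1 α a s s' : tr T1 α a s s' -> alt_tr α a (inL s) (inL s')
| alt_in2 α a s s' : tr T2 α a s s' -> alt_tr α a (inR s) (inR s').

Inductive alt_tm : B -> S -> Prop :=
| alt_tm_ini1 α : tm T1 α (ini T1) -> alt_tm α s0
| alt_tm_ini2 α : tm T2 α (ini T2) -> alt_tm α s0
| alt_tm_in1 α s : tm T1 α s -> alt_tm α (inL s)
| alt_tm_in2 α s : tm T2 α s -> alt_tm α (inR s).

Definition alt_pre : cts := Cts (s0 |` S12) alt_tr alt_tm s0.
Definition alt_cts : cts := conn alt_pre.
End Alt.

(** [T2] is entered through copies of its initial transitions and terminations
    attached to each terminating state of [T1], so that every such state keeps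
    its own transitions and its own termination condition. *)
Section Seq.
Variables T1 T2 : cts.

Inductive seq_tr : B -> A -> S -> S -> Prop :=
| seq_in1 α a s s' : tr T1 α a s s' -> seq_tr α a (inL s) (inL s')
| seq_pass β β' a s s' : tm T1 β s -> tr T2 β' a (ini T2) s' ->
    (β `&` β')%O <> \bot%O -> seq_tr (β `&` β')%O a (inL s) (inR s')
| seq_in2 α a s s' : tr T2 α a s s' -> seq_tr α a (inR s) (inR s').

Inductive seq_tm : B -> S -> Prop :=
| seq_tm_pass β β' s : tm T1 β s -> tm T2 β' (ini T2) ->
    (β `&` β')%O <> \bot%O -> seq_tm (β `&` β')%O (inL s)
| seq_tm_in2 α s : tm T2 α s -> seq_tm α (inR s).

Definition seq_pre : cts :=
  Cts (inL @` st T1 `|` inR @` st T2) seq_tr seq_tm (inL (ini T1)).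
Definition seq_cts : cts := conn seq_pre.
End Seq.

(** The guard is attached to a fresh initial state, so that it does not apply
    again when [T] returns to its own initial state. *)
Section Guard.
Variables (α : B) (T : cts).
Let S1 : set S := inL @` st T.
Let s0 := ch (~` S1).

Inductive guard_tr : B -> A -> S -> S -> Prop :=
| guard_ini β a s' : tr T β a (ini T) s' -> (α `&` β)%O <> \bot%O ->
    guard_tr (α `&` β)%O a s0 (inL s')
| guard_in β a s s' : tr T β a s s' -> guard_tr β a (inL s) (inL s').

Inductive guard_tm : B -> S -> Prop :=
| guard_tm_ini β : tm T β (ini T) -> (α `&` β)%O <> \bot%O ->
    guard_tm (α `&` β)%O s0
| guard_tm_in β s : tm T β s -> guard_tm β (inL s).

Definition guard_pre : cts := Cts (s0 |` S1) guard_tr guard_tm s0.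
Definition guard_cts : cts := conn guard_pre.
End Guard.

Section Par.
Variables T1 T2 : cts.

Inductive sync (α : B) (c : A) (s1 s2 s1' s2' : S) : Prop :=
| Sync α' β' a b of tr T1 α' a s1 s1' & tr T2 β' b s2 s2' &
    gamma (Some a) (Some b) = Some c & α = (α' `&` β')%O & α <> \bot%O.

Inductive par_tr : B -> A -> S -> S -> Prop :=
| par_left α a s1 s1' s2 : tr T1 α a s1 s1' -> st T2 s2 ->
    par_tr α a (pr s1 s2) (pr s1' s2)
| par_right α a s1 s2 s2' : tr T2 α a s2 s2' -> st T1 s1 ->
    par_tr α a (pr s1 s2) (pr s1 s2')
| par_sync α c s1 s2 s1' s2' : sync α c s1 s2 s1' s2' ->
    par_tr α c (pr s1 s2) (pr s1' s2').

Inductive par_tm : B -> S -> Prop :=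
| Par_tm α' β' s1 s2 : tm T1 α' s1 -> tm T2 β' s2 ->
    (α' `&` β')%O <> \bot%O -> par_tm (α' `&` β')%O (pr s1 s2).

Definition par_st : set S := [set pr s1 s2 | s1 in st T1 & s2 in st T2].
Definition par_cts : cts := Cts par_st par_tr par_tm (pr (ini T1) (ini T2)).

Let s0 := ch (~` par_st).

Inductive lmerge_tr : B -> A -> S -> S -> Prop :=
| lmerge_ini α a s : tr T1 α a (ini T1) s -> lmerge_tr α a s0 (pr s (ini T2))
| lmerge_in α a s s' : par_tr α a s s' -> lmerge_tr α a s s'.

Definition lmerge_pre : cts := Cts (s0 |` par_st) lmerge_tr par_tm s0.
Definition lmerge_cts : cts := conn lmerge_pre.

Inductive cmerge_tr : B -> A -> S -> S -> Prop :=
| cmerge_ini α c s1 s2 : sync α c (ini T1) (ini T2) s1 s2 ->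
    cmerge_tr α c s0 (pr s1 s2)
| cmerge_in α a s s' : par_tr α a s s' -> cmerge_tr α a s s'.

Definition cmerge_pre : cts := Cts (s0 |` par_st) cmerge_tr par_tm s0.
Definition cmerge_cts : cts := conn cmerge_pre.
End Par.

Definition encap_pre (H : {set A}) (T : cts) : cts :=
  Cts (st T) (fun α a s s' => tr T α a s s' /\ a \notin H) (tm T) (ini T).
Definition encap_cts (H : {set A}) (T : cts) : cts := conn (encap_pre H T).

(** [CS] and [C'] automatically contain no pair with label [\bot] and no target
    outside the system, because transitions and terminations of an element
    of [Tk] have neither; [supremum \bot] of the empty set is [\bot]. *)
Definition split_sim (T1 T2 : cts) (R : S -> S -> Prop) :=
  forall s1 s2, R s1 s2 ->
    (forall α a s1', tr T1 α a s1 s1' ->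
      exists CS : set (B * S), [/\ card_lt K CS,
        (α <= supremum \bot (fst @` CS))%O &
        forall α' s2', CS (α', s2') -> tr T2 α' a s2 s2' /\ R s1' s2']) /\
    (forall α, tm T1 α s1 ->
      exists C' : set B, [/\ card_lt K C', (α <= supremum \bot C')%O &
        forall α', C' α' -> tm T2 α' s2]).

Definition split_bisim (T1 T2 : cts) := exists R : S -> S -> Prop,
  [/\ forall s1 s2, R s1 s2 -> st T1 s1 /\ st T2 s2,
      R (ini T1) (ini T2),
      split_sim T1 T2 R &
      split_sim T2 T1 (fun s2 s1 => R s1 s2)].

Definition split_bisimb (T1 T2 : Tk) : bool := `[< split_bisim T1 T2 >].
End Systems.

Lemma rel_card_le (T U : Type) (X : set T) (Y : set U) (R : T -> U -> Prop) :
  (forall x, X x -> exists2 y, Y y & R x y) ->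
  (forall x x' y, X x -> X x' -> R x y -> R x' y -> x = x') -> X #<= Y.
Proof.
move=> Rtot Rinj.
have [->|/set0P[x0 Xx0]] := eqVneq X set0; first exact: card_ge0.
have [g gP] : exists g : U -> T,
    forall y, (exists2 x, X x & R x y) -> X (g y) /\ R (g y) y.
  have /choice[g gP] y : exists x, (exists2 x, X x & R x y) -> X x /\ R x y.
    have [[x Xx Rxy]|no] := pselect (exists2 x, X x & R x y).
      by exists x.
    by exists x0.
  by exists g.
apply: (card_le_trans (B := g @` Y)); last exact: card_image_le.
apply: subset_card_le => x Xx; have [y Yy Rxy] := Rtot _ Xx.
exists y => //; have [|Xg Rg] := gP y; first by exists x.
exact: Rinj Rg Rxy.
Qed.

Lemma card_le_rel (T U : Type) (X : set T) (Y : set U) : X #<= Y ->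
  exists R : T -> U -> Prop,
  [/\ forall x, X x -> exists2 y, Y y & R x y,
      forall x y y', R x y -> R x y' -> y = y',
      forall x x' y, R x y -> R x' y -> x = x' &
      forall x y, R x y -> X x /\ Y y].
Proof.
move=> XY; elim/Ppointed: U => U in Y XY *.
  have X0 : X = set0 by apply/(card_le0P U X); rewrite (_ : set0 = Y) // emptyE.
  by exists (fun _ _ => False); split=> // x; rewrite X0.
move/pcard_leP/injfunPex : XY => [f fXY finj].
exists (fun x y => X x /\ f x = y); split.
- by move=> x Xx; exists (f x) => //; exact: fXY.
- by move=> x y y' [_ <-] [_ <-].
- by move=> x x' y [Xx <-] [Xx' e]; apply: finj; rewrite ?inE.
- by move=> x y [Xx <-]; split=> //; exact: fXY.
Qed.

Lemma card_le_total (T U : Type) (X : set T) (Y : set U) : X #<= Y \/ Y #<= X.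
Proof.
pose P (G : set (T * U)) := [/\ forall x y, G (x, y) -> X x /\ Y y,
  forall x y y', G (x, y) -> G (x, y') -> y = y' &
  forall x x' y, G (x, y) -> G (x', y) -> x = x'].
have [F FP Ftot|G [[GXY Gf Gi] Gmax]] := @Zorn_bigcup (T * U) P.
  split.
  - by move=> x y [G FG Gxy]; have [h _ _] := FP _ FG; exact: h Gxy.
  - move=> x y y' [G FG Gxy] [G' FG' Gxy'].
    have [GG'|G'G] := Ftot _ _ FG FG'.
      by have [_ h _] := FP _ FG'; apply: h Gxy'; exact: GG'.
    by have [_ h _] := FP _ FG; apply: h (G'G _ Gxy').
  - move=> x x' y [G FG Gxy] [G' FG' Gxy'].
    have [GG'|G'G] := Ftot _ _ FG FG'.
      by have [_ _ h] := FP _ FG'; apply: h Gxy'; exact: GG'.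
    by have [_ _ h] := FP _ FG; apply: h (G'G _ Gxy').
have [Xdom|/existsNP[x /not_implyP[Xx nx]]] :=
    pselect (forall x, X x -> exists2 y, Y y & G (x, y)).
  by left; apply: (rel_card_le (R := fun x y => G (x, y))) => // x x' y _ _; apply: Gi.
have [Ydom|/existsNP[y /not_implyP[Yy ny]]] :=
    pselect (forall y, Y y -> exists2 x, X x & G (x, y)).
  by right; apply: (rel_card_le (R := fun y x => G (x, y))) => // y y' z _ _; apply: Gf.
have nGx z : ~ G (x, z) by move=> h; apply: nx; exists z => //; have [] := GXY _ _ h.
have nGy z : ~ G (z, y) by move=> h; apply: ny; exists z => //; have [] := GXY _ _ h.
case: (Gmax (G `|` [set (x, y)])).
  split; first by move=> p; left.
  by move=> /(_ (x, y)) h; apply: (nGx y); apply: h; right.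
split.
- by move=> x' y' [/GXY//|[-> ->]].
- move=> a b b' [h|[ea eb]] [h'|[ea' eb']]; subst => //.
  + exact: Gf h h'.
  + by have := nGx _ h.
  + by have := nGx _ h'.
- move=> a b b' [h|[ea eb]] [h'|[ea' eb']]; subst => //.
  + exact: Gi h h'.
  + by have := nGy _ h.
  + by have := nGy _ h'.
Qed.

Lemma card_leX (T T' U U' : Type) (X : set T) (X' : set T') (Y : set U) (Y' : set U') :
  X #<= X' -> Y #<= Y' -> X `*` Y #<= X' `*` Y'.
Proof.
move=> /card_le_rel[R [Rt Rf Ri RX]] /card_le_rel[S [St Sf Si SY]].
apply: (rel_card_le (R := fun p q => R p.1 q.1 /\ S p.2 q.2)).
  move=> [x y] [/= /Rt[x' Xx' Rx] /St[y' Yy' Sy]].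
  by exists (x', y').
move=> [x y] [x' y'] [z t] _ _ [/= Rx Sy] [/= Rx' Sy'].
by rewrite (Ri _ _ _ Rx Rx') (Si _ _ _ Sy Sy').
Qed.

Definition csum (T U : Type) (X : set T) (Y : set U) : set (T + U) :=
  [set p | match p with inl x => X x | inr y => Y y end].

Lemma card_le_sum (T T' U U' : Type) (X : set T) (X' : set T') (Y : set U) (Y' : set U') :
  X #<= X' -> Y #<= Y' -> csum X Y #<= csum X' Y'.
Proof.
move=> /card_le_rel[R [Rt Rf Ri RX]] /card_le_rel[S [St Sf Si SY]].
apply: (rel_card_le (R := fun p q => match p, q with inl x, inl x' => R x x'
   | inr x, inr x' => S x x' | _, _ => False end)).
  move=> [x /Rt[y Yy Rxy]|x /St[y Yy Rxy]]; first by exists (inl y).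
  by exists (inr y).
move=> [x|x] [x'|x'] [y|y] //= Xx Xx' r r'; first by rewrite (Ri _ _ _ r r').
by rewrite (Si _ _ _ r r').
Qed.

Lemma card_leU (T : Type) (X Y : set T) : X `|` Y #<= csum X Y.
Proof.
apply: (rel_card_le (R := fun x p => match p with inl y => x = y | inr y => x = y end)).
  by move=> x [Xx|Yx]; [exists (inl x)|exists (inr x)].
by move=> x x' [y|y] _ _ -> ->.
Qed.

Lemma card_sum_le (T U V : Type) (X : set T) (Y : set U) (A : set V) (a b : V) :
  A a -> A b -> a <> b -> X #<= A -> Y #<= A -> csum X Y #<= A `*` A.
Proof.
move=> Aa Ab ab XA YA; apply: card_le_trans (card_le_sum XA YA) _.
apply: (rel_card_le (R := fun p q => match p with inl x => q = (x, a) | inr x => q = (x, b) end)).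
  by move=> [x|x] /= Ax; [exists (x, a)|exists (x, b)].
move=> [x|x] [y|y] [z t] _ _ [-> e] [-> e']; congr inl || congr inr || case: ab => //; congruence.
Qed.

Section pairing.
Variable T : Type.
Implicit Types G : set (T * T * T).

Definition pdom G : set T := [set x | exists z, G (x, x, z)].
(** [G] is the graph of an injection of the square of its domain into its domain. *)
Definition pairing G := [/\
  forall x y z, G (x, y, z) -> [/\ pdom G x, pdom G y & pdom G z],
  forall x y, pdom G x -> pdom G y -> exists z, G (x, y, z),
  forall x y z z', G (x, y, z) -> G (x, y, z') -> z = z' &
  forall x y x' y' z, G (x, y, z) -> G (x', y', z) -> x = x' /\ y = y'].

Lemma pairing_sq G : pairing G -> pdom G `*` pdom G #<= pdom G.
Proof.
move=> [Gd Gt Gf Gi]; apply: (rel_card_le (R := fun p z => G (p, z))).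
  move=> [x y] [/= Gx Gy]; have [z Gz] := Gt _ _ Gx Gy.
  by exists z => //; have [] := Gd _ _ _ Gz.
by move=> [x y] [x' y'] z _ _ g g'; have [-> ->] := Gi _ _ _ _ _ g g'.
Qed.

Lemma pairing_of_sq (A : set T) : A `*` A #<= A ->
  exists2 G, pairing G & pdom G = A.
Proof.
move=> /card_le_rel[R [Rt Rf Ri RA]].
exists [set p | R p.1 p.2].
  have dE x : pdom [set p | R p.1 p.2] x <-> A x.
    split; first by move=> [z] /RA[[]].
    by move=> Ax; have [z Az Rz] := Rt (x, x) (conj Ax Ax); exists z.
  split.
  - by move=> x y z /RA/=[[/= Ax Ay] Az]; split; apply/dE.
  - move=> x y /dE Ax /dE Ay.
    by have [z Az Rz] := Rt (x, y) (conj Ax Ay); exists z.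
  - by move=> x y z z' /Rf h /h.
  - by move=> x y x' y' z /Ri h /h[].
apply/seteqP; split; first by move=> x [z] /RA[[]].
by move=> x Ax; have [z Az Rz] := Rt (x, x) (conj Ax Ax); exists z.
Qed.

Lemma infinite_sq (X : set T) : infinite_set X -> X `*` X #<= X.
Proof.
move=> Xinf.
have [N [NX Ninf Nsq]] : exists N : set T, [/\ N `<=` X, infinite_set N & N `*` N #<= N].
  move/infiniteP : Xinf => /card_le_rel[R [Rt Rf Ri RX]].
  have := Rt; move=> /(_ _ I) H.
  have /choice[f fP] n : exists x, X x /\ R n x by have [x] := Rt n I; exists x.
  have finj : injective f.
    by move=> m n e; have [_ h] := fP m; have [_ h'] := fP n; apply: Ri h _; rewrite e.
  have Neq : f @` [set: nat] #= [set: nat] by apply: inj_card_eq => ? ? _ _ /finj.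
  exists (f @` setT); split.
  - by move=> _ [n _ <-]; have [] := fP n.
  - by apply/infiniteP; have /card_eqPle[] := Neq.
  - move/card_eqPle : Neq => [le ge].
    apply: card_le_trans (card_leX le le) _; apply: card_le_trans _ ge.
    by rewrite -/(countable _); exact: countableX.
have [G0 G0p G0d] := pairing_of_sq Nsq.
pose P G := G = set0 \/ [/\ G0 `<=` G, pairing G & pdom G `<=` X].
have [F FP Ftot|G [PG Gmax]] := @Zorn_bigcup _ P.
  have [Fn|/existsNP[G1 /not_implyP[FG1 /eqP/set0P[p0 G1p0]]]] :=
    pselect (forall G, F G -> G = set0).
    left; apply/seteqP; split=> // p [G /Fn ->//].
  have FP' G : F G -> forall p, G p -> [/\ G0 `<=` G, pairing G & pdom G `<=` X].
    by move=> FG p Gp; have [GE|//] := FP _ FG; rewrite GE in Gp.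
  have pdomU G x : F G -> pdom G x -> pdom (\bigcup_(G in F) G) x.
    by move=> FG [z Gz]; exists z, G.
  have big G x G' y : F G -> pdom G x -> F G' -> pdom G' y ->
      exists H, [/\ F H, pairing H, pdom H x & pdom H y].
    move=> FG Gx FG' Gy; have [z Gz] := Gx; have [z' Gz'] := Gy.
    have [GG'|G'G] := Ftot _ _ FG FG'.
      exists G'; have [_ pG' _] := FP' _ FG' _ Gz'; split=> //.
      by exists z; exact: GG'.
    exists G; have [_ pG _] := FP' _ FG _ Gz; split=> //.
    by exists z'; exact: G'G.
  have big2 p q : (\bigcup_(G in F) G) p -> (\bigcup_(G in F) G) q ->
      exists H, [/\ F H, pairing H, H p & H q].
    move=> [G FG Gp] [G' FG' Gq].
    have [GG'|G'G] := Ftot _ _ FG FG'.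
      exists G'; have [_ pG' _] := FP' _ FG' _ Gq; split=> //.
      exact: GG'.
    exists G; have [_ pG _] := FP' _ FG _ Gp; split=> //.
    exact: G'G.
  right; split.
  - by have [G01 _ _] := FP' _ FG1 _ G1p0; move=> p /G01 G1p; exists G1.
  - split.
    + move=> x y z h; have [H [FH [Hd _ _ _] Hp _]] := big2 _ _ h h.
      by have [hx hy hz] := Hd _ _ _ Hp; split; apply: pdomU FH _.
    + move=> x y [z [G FG Gz]] [z' [G' FG' Gz']].
      have Gx : pdom G x by exists z.
      have Gy : pdom G' y by exists z'.
      have [H [FH [_ Ht _ _] Hx Hy]] := big G x G' y FG Gx FG' Gy.
      by have [t Ht'] := Ht _ _ Hx Hy; exists t, H.
    + move=> x y z z' h h'; have [H [_ [_ _ Hf _] Hh Hh']] := big2 _ _ h h'.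
      exact: Hf Hh Hh'.
    + move=> x y x' y' z h h'; have [H [_ [_ _ _ Hi] Hh Hh']] := big2 _ _ h h'.
      exact: Hi Hh Hh'.
  - move=> x [z [G FG Gz]]; have [_ _] := FP' _ FG _ Gz; apply.
    by exists z.
have PG0 : P G0 by right; split=> //; rewrite G0d.
have [GE|[G0G Gp GX]] := PG.
  subst G; case: (Gmax G0) => //; split; first exact: sub0set.
  move=> G00; have : finite_set N.
    rewrite (_ : N = set0) //; apply/seteqP; split=> // x; rewrite -G0d.
    by move=> [z /G00].
  by [].
set A := pdom G in GX.
have Asq : A `*` A #<= A by exact: pairing_sq.
have Ainf : infinite_set A.
  apply: sub_infinite_set Ninf; rewrite -G0d => x [z /G0G Gz].
  by exists z.
have [a [b [Aa Ab ab]]] : exists a b, [/\ A a, A b & a <> b].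
  move/infiniteP : Ainf => /card_le_rel[R [Rt _ Ri _]].
  have [a Aa Ra] := Rt 0 I; have [b Ab Rb] := Rt 1 I.
  by exists a, b; split=> // e; subst b; have := Ri _ _ _ Ra Rb.
have [XA|AX] := card_le_total (X `\` A) A.
  have XA' : X #<= A.
    apply: card_le_trans Asq; apply: card_le_trans (card_sum_le Aa Ab ab (card_lexx _) XA).
    apply: card_le_trans (card_leU _ _); apply: subset_card_le => x Xx.
    by have [Ax|nAx] := pselect (A x); [left|right].
  apply: card_le_trans (card_leX XA' XA') _; apply: card_le_trans Asq _.
  exact: subset_card_le.
have [A' [A'X AA' A'A]] : exists A', [/\ A' `<=` X `\` A, A #<= A' & A' #<= A].
  have [R [Rt Rf Ri RA]] := card_le_rel AX.
  exists [set y | exists2 x, A x & R x y]; split.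
  - by move=> y [x _ /RA[]].
  - apply: (rel_card_le (R := R)) => [x Ax|x x' y _ _]; last exact: Ri.
    by have [y _ Rxy] := Rt _ Ax; exists y => //; exists x.
  - apply: (rel_card_le (R := fun y x => R x y)) => [y [x Ax Rxy]|]; first by exists x.
    by move=> y y' x _ _; exact: Rf.
set D := A `|` A'.
have DA : D #<= A.
  apply: card_le_trans Asq; apply: card_le_trans (card_leU _ _) _.
  exact: card_sum_le Aa Ab ab _ _.
have DA' : D `*` D #<= A'.
  by apply: card_le_trans AA'; apply: card_le_trans Asq; exact: card_leX.
have [R [Rt Rf Ri RA]] := card_le_rel DA'.
pose G' := G `|` [set p | R p.1 p.2 /\ ~ (A p.1.1 /\ A p.1.2)].
have [Gd Gt Gf Gi] := Gp.
have DE : pdom G' = D.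
  apply/seteqP; split=> x.
    move=> [z [Gz|[/RA[[]]//]]].
    by left; exists z.
  move=> Dx; have [Ax|nAx] := pselect (A x).
    by have [z Gz] := Ax; exists z; left.
  have [z A'z Rz] := Rt (x, x) (conj Dx Dx).
  by exists z; right; split=> // -[].
have nA z : A' z -> ~ A z by move=> /A'X[].
case: (Gmax G'); last first.
  right; split; first by move=> p /G0G; left.
    split; rewrite ?DE.
    - move=> x y z [/Gd[Ax Ay Az]|[/RA/=[[/= Dx Dy] A'z] _]]; first by split; left.
      by split=> //; right.
    - move=> x y Dx Dy; have [[Ax Ay]|nA2] := pselect (A x /\ A y).
        by have [z Gz] := Gt _ _ Ax Ay; exists z; left.
      have [z A'z Rz] := Rt (x, y) (conj Dx Dy).
      by exists z; right.
    - move=> x y z z' [Gz|[Rz /= n1]] [Gz'|[Rz' /= n2]].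
      + exact: Gf Gz Gz'.
      + by case: n2; have [] := Gd _ _ _ Gz.
      + by case: n1; have [] := Gd _ _ _ Gz'.
      + exact: Rf Rz Rz'.
    - move=> x y x' y' z [Gz|[Rz /= n1]] [Gz'|[Rz' /= n2]].
      + exact: Gi Gz Gz'.
      + by have [_ /nA] := RA _ _ Rz'; case; have [] := Gd _ _ _ Gz.
      + by have [_ /nA] := RA _ _ Rz; case; have [] := Gd _ _ _ Gz'.
      + by have [-> ->] := Ri _ _ _ Rz Rz'.
  by rewrite DE => x [|/A'X[]//]; exact: GX.
split; first by move=> p; left.
move=> G'G; have /card_le_rel[S [St _ _ _]] := AA'.
have [y A'y _] := St _ Aa; apply: (nA _ A'y).
have Dy : D y by right.
have : pdom G' y by rewrite DE.
by move=> [z /G'G Gz]; exists z.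
Qed.
End pairing.

Section card_lt.
Variable K : Type.
Local Notation card_lt := (card_lt K).
Hypothesis Kinf : infinite_set [set: K].

Lemma card_lt_le (T U : Type) (X : set T) (Y : set U) :
  X #<= Y -> card_lt Y -> card_lt X.
Proof.
move=> XY /andP[YK nKY]; apply/andP; split; first exact: card_le_trans XY YK.
by apply: contra nKY => /card_le_trans; exact.
Qed.

Lemma card_lt_finite (T : Type) (X : set T) : finite_set X -> card_lt X.
Proof.
move=> fX; have nKX : ~~ ([set: K] #<= X).
  by apply/negP => KX; apply: Kinf; exact: card_le_finite KX fX.
apply/andP; split=> //.
by have [//|h] := card_le_total X [set: K]; rewrite h in nKX.
Qed.

Lemma card_ltX (T U : Type) (X : set T) (Y : set U) :
  card_lt X -> card_lt Y -> card_lt (X `*` Y).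
Proof.
suff H (V W : Type) (Z : set V) (Z' : set W) :
    card_lt Z -> card_lt Z' -> Z' #<= Z -> card_lt (Z `*` Z').
  move=> cX cY; have [YX|XY] := card_le_total Y X; first exact: H.
  apply: card_lt_le (H _ _ _ _ cY cX XY).
  apply: (rel_card_le (R := fun p q => p = (q.2, q.1))).
    by move=> [x y] [/= Xx Yy]; exists (y, x).
  by move=> p q r _ _ -> ->.
move=> cZ cZ' ZZ'; have [fZ|iZ] := pselect (finite_set Z).
  apply: card_lt_finite; apply: finite_setX => //.
  exact: card_le_finite ZZ' fZ.
apply: card_lt_le cZ; apply: card_le_trans (infinite_sq iZ).
exact: card_leX.
Qed.

Lemma card_lt_sum (T U : Type) (X : set T) (Y : set U) :
  card_lt X -> card_lt Y -> card_lt (csum X Y).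
Proof.
have cb : card_lt [set: bool] by apply: card_lt_finite.
move=> cX cY.
have [->|/set0P[x0 Xx0]] := eqVneq X set0.
  apply: card_lt_le cY.
  apply: (rel_card_le (R := fun p y => p = inr y)).
    by move=> [x|x] //= Yx; exists x.
  by move=> p q y _ _ -> ->.
have [->|/set0P[y0 Yy0]] := eqVneq Y set0.
  apply: card_lt_le cX.
  apply: (rel_card_le (R := fun p y => p = inl y)).
    by move=> [x|x] //= Yx; exists x.
  by move=> p q y _ _ -> ->.
apply: card_lt_le (card_ltX (card_ltX cX cY) cb).
apply: (rel_card_le (R := fun p q => match p with inl x => q = ((x, y0), true)
  | inr y => q = ((x0, y), false) end)).
  by move=> [x|y] /= h; [exists ((x, y0), true)|exists ((x0, y), false)].
by move=> [x|x] [y|y] [[z t] c] _ _ -> [] // -> //.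
Qed.

Lemma card_lt_setU (T : Type) (X Y : set T) :
  card_lt X -> card_lt Y -> card_lt (X `|` Y).
Proof. by move=> cX cY; apply: card_lt_le (card_leU X Y) (card_lt_sum cX cY). Qed.

Lemma card_lt_image (T U : Type) (f : T -> U) (X : set T) :
  card_lt X -> card_lt (f @` X).
Proof. exact: card_lt_le (card_image_le f X). Qed.
End card_lt.

Import Order.TTheory Order.CTheory.

Section Closure.
Variables (A : finType) (gamma : option A -> option A -> option A).
Variables (K C : Type) (d : Order.disp_t) (B : ctbDistrLatticeType d) (gen : C -> B).
Variable (S : state_universe K).
Hypotheses (Kinf : infinite_set [set: K]) (HB : free_kcomplete K gen).
Local Notation cts := (cts A B S).

Lemma top_neq_bot : \top%O <> \bot%O :> B.
Proof.
have bK : kcomplete K bool.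
  move=> X _; have [Xt|nXt] := pselect (X true); [exists true|exists false].
    by split=> [[]//|u /(_ _ Xt)].
  by split=> [[]//|u _]; case: u.
have [h [[[hC hS] _] _]] := HB.2 _ _ (fun=> true) bK.
have h0 : h \bot%O = false.
  have [_] : supremums (h @` set0) (h \bot%O).
    apply: hS; first by apply: card_lt_finite.
    by split=> [x []|u _]; exact: le0x.
  by move/(_ false); case: (h _) => // H; have : is_true false by apply: H => x [].
by move=> /(congr1 h); rewrite -compl0 hC h0.
Qed.

Lemma le_supremum (X : set B) α : card_lt K X ->
  (α <= supremum \bot X)%O <-> (forall u, ubound X u -> (α <= u)%O).
Proof.
move=> cX; have [y yX] := HB.1 _ cX.
have -> : supremum \bot%O X = y.
  rewrite /supremum; case: ifPn => [/eqP X0|_].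
    by apply/esym/eqP; rewrite -lex0; apply: yX.2; rewrite X0 => x [].
  exact: (is_subset1_supremums (xgetPex _ (ex_intro _ y yX)) yX).
split=> [ay u uX|]; last by apply; exact: yX.1.
exact: le_trans ay (yX.2 _ uX).
Qed.

Lemma proper_setTP (X : set S) : X `<` [set: S] <-> exists x, ~ X x.
Proof.
split=> [[_ h]|[x nXx]]; last by split=> // /(_ x I).
by apply/existsNP => H; apply: h => x _; exact: H.
Qed.

Lemma fresh (X : set S) x y : x <> y -> ~ X x -> ~ X y ->
  ~ X (ch (~` X)) /\ (ch (~` X) |` X) `<` [set: S].
Proof.
move=> xy nx ny; split; first by apply: (@chP _ S (~` X)); exists x.
apply/proper_setTP; have [xs|xs] := pselect (x = ch (~` X)); [exists y|exists x] => -[] //.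
by rewrite /= -xs => yx; apply: xy.
Qed.

Lemma reach_conn (T : cts) s : reach T s -> reach (conn T) s.
Proof.
elim=> [|α a s1 s2 r IH h]; first exact: (@reach_ini _ _ _ _ _ (conn T)).
by apply: reach_tr IH (And3 h r _); exact: reach_tr r h.
Qed.

Lemma wf_reach (T : cts) s : wf T -> reach T s -> st T s.
Proof. by move=> wT; elim=> [|α a s1 s2 _ _ /(wf_tr wT)[]//]; exact: wf_ini. Qed.

Lemma wf_conn (T : cts) : wf T -> wf (conn T).
Proof.
move=> wT; split.
- by split; [exact: wf_ini|exact: reach_ini].
- by move=> α a s s' [/(wf_tr wT)[? ? ?] ? ?].
- by move=> α s [/(wf_tm wT)[? ?] ?].
- by have /proper_setTP[x nx] := wf_proper wT; apply/proper_setTP; exists x => -[].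
- move=> s [/(wf_branching wT) + _]; apply: card_lt_le; apply: subset_card_le.
  by move=> [[[α a] s']|α] [].
Qed.

Definition conn_Tk (T : cts) (wT : wf T) : Tk A B S :=
  MkTk (wf_conn wT) (fun s => fun h => reach_conn h.2).

Definition simB (T1 T2 : cts) (R : S -> S -> Prop) := forall s t, R s t ->
  (forall α a s', tr T1 α a s s' -> forall u : B,
     (forall α' t', tr T2 α' a t t' -> R s' t' -> (α' <= u)%O) -> (α <= u)%O) /\
  (forall α, tm T1 α s -> forall u : B,
     (forall α', tm T2 α' t -> (α' <= u)%O) -> (α <= u)%O).

Lemma split_sim_simB (T1 T2 : cts) R : split_sim T1 T2 R -> simB T1 T2 R.
Proof.
move=> H s t /H[Htr Htm]; split.
  move=> α a s' /Htr[CS [cCS /le_supremum h hCS]] u hu.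
  apply: h; first exact: card_lt_image.
  by move=> _ [[α' t'] /= /hCS[h1 h2] <-]; exact: hu h2.
move=> α /Htm[C' [cC' /le_supremum h hC']] u hu.
by apply: h => // α' /hC'; exact: hu.
Qed.

Lemma simB_split_sim (T1 T2 : cts) R : wf T2 ->
  (forall s t, R s t -> st T2 t) -> simB T1 T2 R -> split_sim T1 T2 R.
Proof.
move=> wT2 RT H s t Rst; have [Htr Htm] := H _ _ Rst.
have cout := wf_branching wT2 (RT _ _ Rst); split.
  move=> α a s' /Htr h.
  exists [set p | tr T2 p.1 a t p.2 /\ R s' p.2].
  have cCS : card_lt K [set p | tr T2 p.1 a t p.2 /\ R s' p.2].
    apply: card_lt_le cout.
    apply: (rel_card_le (R := fun p x => x = inl (p.1, a, p.2))).
      by move=> [α' t'] /= [h1 _]; exists (inl (α', a, t')).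
    by move=> [? ?] [? ?] x _ _ /= -> -[-> ->].
  split=> //.
  apply/le_supremum; first exact: card_lt_image.
  move=> u uu; apply: h => α' t' h1 h2; apply: uu.
  by exists (α', t').
move=> α /Htm h; exists [set α' | tm T2 α' t].
have cC : card_lt K [set α' | tm T2 α' t].
  apply: card_lt_le cout; apply: (rel_card_le (R := fun p x => x = inr p)).
    by move=> α' /= h1; exists (inr α').
  by move=> ? ? x _ _ /= -> -[].
by split=> //; apply/le_supremum => // u uu; apply: h => α' h1; exact: uu.
Qed.

Lemma simBP (T1 T2 : cts) R : wf T1 -> wf T2 -> R (ini T1) (ini T2) ->
  simB T1 T2 R -> simB T2 T1 (fun t s => R s t) -> split_bisim T1 T2.
Proof.
move=> w1 w2 Ri s12 s21; exists (fun s t => [/\ R s t, st T1 s & st T2 t]).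
split; first by move=> s t [].
- by split=> //; exact: wf_ini.
- apply: simB_split_sim => //; first by move=> s t [].
  move=> s t [Rst Ss St]; have [Htr Htm] := s12 _ _ Rst; split=> //.
  move=> α a s' h u hu; apply: Htr (h) _ _ => α' t' h1 h2; apply: hu (h1) _.
  by split=> //; [have [] := wf_tr w1 h|have [] := wf_tr w2 h1].
- apply: simB_split_sim => //; first by move=> s t [].
  move=> s t [Rst Ss St]; have [Htr Htm] := s21 _ _ Rst; split=> //.
  move=> α a s' h u hu; apply: Htr (h) _ _ => α' t' h1 h2; apply: hu (h1) _.
  by split=> //; [have [] := wf_tr w1 h1|have [] := wf_tr w2 h].
Qed.

Lemma simB_conn (T1 T2 : cts) R : simB T1 T2 R ->
  simB (conn T1) (conn T2) (fun s t => [/\ R s t, reach T1 s & reach T2 t]).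
Proof.
move=> H s t [/H[Htr Htm] r1 r2]; split.
  move=> α a s' [h _ rs'] u hu; apply: Htr (h) _ _ => α' t' h1 h2.
  have rt' : reach T2 t' by exact: reach_tr r2 h1.
  by apply: (hu _ t').
by move=> α [h _] u hu; apply: Htm (h) _ _ => α' h1; apply: hu.
Qed.

Lemma simB_flip (T1 T2 : cts) (R R' : S -> S -> Prop) :
  (forall s t, R s t <-> R' s t) -> simB T1 T2 R -> simB T1 T2 R'.
Proof.
by move=> E; rewrite (_ : R = R') //; apply/funext => s; apply/funext => t; exact/propext.
Qed.

Lemma conn_bisim (T1 T2 : cts) R : wf T1 -> wf T2 -> R (ini T1) (ini T2) ->
  simB T1 T2 R -> simB T2 T1 (fun t s => R s t) -> split_bisim (conn T1) (conn T2).
Proof.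
move=> w1 w2 Ri s12 s21.
apply: (simBP (R := fun s t => [/\ R s t, reach T1 s & reach T2 t])).
- exact: wf_conn.
- exact: wf_conn.
- by split=> //; exact: reach_ini.
- exact: simB_conn.
- apply: simB_flip (simB_conn s21) => s t; by split=> -[].
Qed.

Lemma split_bisimP (T1 T2 : cts) : split_bisim T1 T2 -> exists R,
  [/\ forall s t, R s t -> st T1 s /\ st T2 t, R (ini T1) (ini T2),
      simB T1 T2 R & simB T2 T1 (fun t s => R s t)].
Proof. by move=> [R [RS Ri s12 s21]]; exists R; split=> //; exact: split_sim_simB. Qed.

Lemma split_bisim_refl (T : Tk A B S) : split_bisim T T.
Proof.
have w := sys_wf T.
apply: (simBP (R := eq)) => // s t e; subst; split.
- by move=> α a s' h u; apply; first exact: h.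
- by move=> α h u; apply.
- by move=> α a s' h u; apply; first exact: h.
- by move=> α h u; apply.
Qed.

Lemma split_bisim_sym (T1 T2 : cts) : split_bisim T1 T2 -> split_bisim T2 T1.
Proof.
move=> [R [RS Ri s12 s21]]; exists (fun t s => R s t); split=> //.
by move=> s t /RS[].
Qed.

Lemma simB_trans (T1 T2 T3 : cts) R R' : simB T1 T2 R -> simB T2 T3 R' ->
  simB T1 T3 (fun s t => exists2 r, R s r & R' r t).
Proof.
move=> H H' s t [r /H[Htr Htm] /H'[Htr' Htm']]; split.
  move=> α a s' h u hu; apply: Htr (h) _ _ => α' r' h1 h2.
  apply: Htr' (h1) _ _ => α'' t' h3 h4; apply: hu (h3) _.
  by exists r'.
by move=> α h u hu; apply: Htm (h) _ _ => α' h1; apply: Htm' (h1) _ _.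
Qed.

Lemma split_bisim_trans (T2 T1 T3 : Tk A B S) :
  split_bisim T1 T2 -> split_bisim T2 T3 -> split_bisim T1 T3.
Proof.
move=> /split_bisimP[R [RS Ri s12 s21]] /split_bisimP[R' [RS' Ri' s23 s32]].
apply: (simBP (R := fun s t => exists2 r, R s r & R' r t)).
- exact: sys_wf.
- exact: sys_wf.
- by exists (ini T2).
- exact: simB_trans s12 s23.
- apply: simB_flip (simB_trans s32 s21) => s t.
  by split=> -[r h1 h2]; exists r.
Qed.

Lemma State_inf : infinite_set [set: S].
Proof. by move=> fS; apply: Kinf; exact: card_le_finite (card_State S) fS. Qed.

Lemma finite_proper (X : set S) : finite_set X -> X `<` [set: S].
Proof.
move=> fX; apply/proper_setTP; apply: contrapT => H; apply: State_inf.
by apply: sub_finite_set fX => x _; apply: contrapT => h; apply: H; exists x.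
Qed.

Lemma wf_delta : wf (delta_cts A B S).
Proof.
split=> //; first by apply: finite_proper; exact: finite_set1.
move=> s _; apply: card_lt_finite => //; rewrite (_ : out _ _ = set0) //.
by apply/seteqP; split=> // -[[[]]|].
Qed.

Lemma wf_eps : wf (eps_cts A B S).
Proof.
split=> //.
- by move=> α s [-> ->]; split=> //; exact: top_neq_bot.
- by apply: finite_proper; exact: finite_set1.
move=> s _; apply: card_lt_finite => //.
apply: sub_finite_set (finite_set1 (inr \top%O)).
by move=> [[[]]|α] //= [-> _].
Qed.

Lemma wf_act (a : A) : wf (act_cts B S a).
Proof.
split=> //.
- by left.
- by move=> α b s s' [-> _ -> ->]; split; [exact: top_neq_bot|left|right].
- by move=> α s [-> ->]; split; [exact: top_neq_bot|right].
- by apply: finite_proper; apply: finite_set2.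
move=> s _; apply: card_lt_finite => //.
apply: sub_finite_set (finite_set2 (inl (\top%O, a, ch (~` [set ch [set: S]]))) (inr \top%O)).
by move=> [[[α b] s']|α] /=; [move=> [-> -> _ ->]; left|move=> [-> _]; right].
Qed.

Definition delta_Tk : Tk A B S.
Proof.
apply: (MkTk wf_delta) => s ->; exact: (@reach_ini _ _ _ _ _ (delta_cts A B S)).
Defined.

Definition eps_Tk : Tk A B S.
Proof.
apply: (MkTk wf_eps) => s ->; exact: (@reach_ini _ _ _ _ _ (eps_cts A B S)).
Defined.

Definition act_Tk (a : A) : Tk A B S.
Proof.
apply: (MkTk (wf_act a)); have r0 := @reach_ini _ _ _ _ _ (act_cts B S a).
move=> s [->|->]; first exact: r0.
exact: (@reach_tr _ _ _ _ _ (act_cts B S a) \top%O a _ _ r0).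
Defined.

Definition omap_out (f : B -> B) (g : S -> S) (x : B * A * S + B) : B * A * S + B :=
  match x with inl (α, a, s) => inl (f α, a, g s) | inr α => inr (f α) end.

Lemma card_lt_sub (T : Type) (X Y : set T) : X `<=` Y -> card_lt K Y -> card_lt K X.
Proof. by move=> XY; apply: card_lt_le; exact: subset_card_le. Qed.

Section AltC.
Variables T1 T2 : cts.
Hypotheses (w1 : wf T1) (w2 : wf T2).
Let S12 : set S := inL @` st T1 `|` inR @` st T2.
Let s0 := ch (~` S12).

Lemma alt_fresh : ~ S12 s0 /\ (s0 |` S12) `<` [set: S].
Proof.
have /proper_setTP[x nx] := wf_proper w1; have /proper_setTP[y ny] := wf_proper w2.
apply: (@fresh _ (inL x) (inR y)); first exact: inLR.
  by move=> [[x' + /inL_inj e]|[y' _ /esym/inLR//]]; rewrite e.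
by move=> [[x' _ /inLR//]|[y' + /inR_inj e]]; rewrite e.
Qed.

Lemma alt_s0L s : st T1 s -> s0 <> inL s.
Proof. by move=> h e; have [] := alt_fresh; rewrite e => H; case: H; left; exists s. Qed.
Lemma alt_s0R s : st T2 s -> s0 <> inR s.
Proof. by move=> h e; have [] := alt_fresh; rewrite e => H; case: H; right; exists s. Qed.

Lemma alt_tr0 α a s' : tr (alt_pre T1 T2) α a s0 s' ->
  (exists2 x, s' = inL x & tr T1 α a (ini T1) x) \/
  (exists2 x, s' = inR x & tr T2 α a (ini T2) x).
Proof.
move=> h; move: {-1}s0 (erefl s0) h => t et h.
case: h et => [{}α {}a x h _|{}α {}a x h _|{}α {}a s x h e|{}α {}a s x h e].
- by left; exists x.
- by right; exists x.
- by have [_ /alt_s0L/(_ e)] := wf_tr w1 h.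
- by have [_ /alt_s0R/(_ e)] := wf_tr w2 h.
Qed.

Lemma alt_trL α a s s' : st T1 s -> tr (alt_pre T1 T2) α a (inL s) s' ->
  exists2 x, s' = inL x & tr T1 α a s x.
Proof.
move=> Ss h; move: {-1}(inL s) (erefl (inL s)) h => t et h.
case: h et => [{}α {}a x h e|{}α {}a x h e|{}α {}a u x h e|{}α {}a u x h e].
- by have := alt_s0L Ss; rewrite e.
- by have := alt_s0L Ss; rewrite e.
- by exists x => //; rewrite (inL_inj e).
- by have /inLR := e.
Qed.

Lemma alt_trR α a s s' : st T2 s -> tr (alt_pre T1 T2) α a (inR s) s' ->
  exists2 x, s' = inR x & tr T2 α a s x.
Proof.
move=> Ss h; move: {-1}(inR s) (erefl (inR s)) h => t et h.
case: h et => [{}α {}a x h e|{}α {}a x h e|{}α {}a u x h e|{}α {}a u x h e].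
- by have := alt_s0R Ss; rewrite e.
- by have := alt_s0R Ss; rewrite e.
- by have /esym/inLR := e.
- by exists x => //; rewrite (inR_inj e).
Qed.

Lemma alt_tm0 α : tm (alt_pre T1 T2) α s0 -> tm T1 α (ini T1) \/ tm T2 α (ini T2).
Proof.
move=> h; move: {-1}s0 (erefl s0) h => t et h.
case: h et => [{}α h _|{}α h _|{}α s h e|{}α s h e].
- by left.
- by right.
- by have [_ /alt_s0L/(_ e)] := wf_tm w1 h.
- by have [_ /alt_s0R/(_ e)] := wf_tm w2 h.
Qed.

Lemma alt_tmL α s : st T1 s -> tm (alt_pre T1 T2) α (inL s) -> tm T1 α s.
Proof.
move=> Ss h; move: {-1}(inL s) (erefl (inL s)) h => t et h.
case: h et => [{}α h e|{}α h e|{}α u h e|{}α u h e].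
- by have := alt_s0L Ss; rewrite e.
- by have := alt_s0L Ss; rewrite e.
- by rewrite (inL_inj e).
- by have /inLR := e.
Qed.

Lemma alt_tmR α s : st T2 s -> tm (alt_pre T1 T2) α (inR s) -> tm T2 α s.
Proof.
move=> Ss h; move: {-1}(inR s) (erefl (inR s)) h => t et h.
case: h et => [{}α h e|{}α h e|{}α u h e|{}α u h e].
- by have := alt_s0R Ss; rewrite e.
- by have := alt_s0R Ss; rewrite e.
- by have /esym/inLR := e.
- by rewrite (inR_inj e).
Qed.

Lemma wf_alt : wf (alt_pre T1 T2).
Proof.
split.
- by left.
- move=> α a s s' []{α a s s'} α a.
  + by move=> s' /(wf_tr w1)[h _ h']; split=> //; [left|right; left; exists s'].
  + by move=> s' /(wf_tr w2)[h _ h']; split=> //; [left|right; right; exists s'].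
  + move=> s s' /(wf_tr w1)[h h1 h'].
    by split=> //; [right; left; exists s|right; left; exists s'].
  + move=> s s' /(wf_tr w2)[h h1 h'].
    by split=> //; [right; right; exists s|right; right; exists s'].
- move=> α s []{α s} α.
  + by move=> /(wf_tm w1)[h _]; split=> //; left.
  + by move=> /(wf_tm w2)[h _]; split=> //; left.
  + by move=> s /(wf_tm w1)[h h1]; split=> //; right; left; exists s.
  + by move=> s /(wf_tm w2)[h h1]; split=> //; right; right; exists s.
- by have [] := alt_fresh.
- have c1 s (h : st T1 s) := card_lt_image (omap_out id inL) (wf_branching w1 h).
  have c2 s (h : st T2 s) := card_lt_image (omap_out id inR) (wf_branching w2 h).
  move=> s [->|[[x Tx <-]|[x Tx <-]]].
  + apply: card_lt_sub (card_lt_setU Kinf (c1 _ (wf_ini w1)) (c2 _ (wf_ini w2))).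
    move=> [[[α a] s']|α] /=.
      move=> /alt_tr0[[x -> h]|[x -> h]]; [left|right];
      by exists (inl (α, a, x)).
    by move=> /alt_tm0[h|h]; [left|right]; exists (inr α).
  + apply: card_lt_sub (c1 _ Tx) => -[[[α a] s']|α] /=.
      by move=> /(alt_trL Tx)[y -> h]; exists (inl (α, a, y)).
    by move=> /(alt_tmL Tx) h; exists (inr α).
  + apply: card_lt_sub (c2 _ Tx) => -[[[α a] s']|α] /=.
      by move=> /(alt_trR Tx)[y -> h]; exists (inl (α, a, y)).
    by move=> /(alt_tmR Tx) h; exists (inr α).
Qed.
End AltC.

Section SeqC.
Variables T1 T2 : cts.
Hypotheses (w1 : wf T1) (w2 : wf T2).

Lemma seq_trL α a s s' : tr (seq_pre T1 T2) α a (inL s) s' ->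
  (exists2 x, s' = inL x & tr T1 α a s x) \/
  (exists β β' x, [/\ s' = inR x, α = (β `&` β')%O, tm T1 β s &
     tr T2 β' a (ini T2) x]).
Proof.
move=> h; move: {-1}(inL s) (erefl (inL s)) h => t et h.
case: h et => [{}α {}a u x h e|β β' {}a u x h h' _ e|{}α {}a u x h e].
- by left; exists x => //; rewrite (inL_inj e).
- by right; exists β, β', x; split=> //; rewrite (inL_inj e).
- by have /inLR := e.
Qed.

Lemma seq_trR α a s s' : tr (seq_pre T1 T2) α a (inR s) s' ->
  exists2 x, s' = inR x & tr T2 α a s x.
Proof.
move=> h; move: {-1}(inR s) (erefl (inR s)) h => t et h.
case: h et => [{}α {}a u x h e|β β' {}a u x h h' _ e|{}α {}a u x h e].
- by have /esym/inLR := e.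
- by have /esym/inLR := e.
- by exists x => //; rewrite (inR_inj e).
Qed.

Lemma seq_tmL α s : tm (seq_pre T1 T2) α (inL s) ->
  exists β β', [/\ α = (β `&` β')%O, tm T1 β s & tm T2 β' (ini T2)].
Proof.
move=> h; move: {-1}(inL s) (erefl (inL s)) h => t et h.
case: h et => [β β' u h h' _ e|{}α u h e].
- by exists β, β'; split=> //; rewrite (inL_inj e).
- by have /inLR := e.
Qed.

Lemma seq_tmR α s : tm (seq_pre T1 T2) α (inR s) -> tm T2 α s.
Proof.
move=> h; move: {-1}(inR s) (erefl (inR s)) h => t et h.
case: h et => [β β' u h h' _ e|{}α u h e].
- by have /esym/inLR := e.
- by rewrite (inR_inj e).
Qed.

Lemma wf_seq : wf (seq_pre T1 T2).
Proof.
split.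
- by left; exists (ini T1) => //; exact: wf_ini.
- move=> α a s s' []{α a s s'}.
  + move=> α a s s' /(wf_tr w1)[h h1 h']; split=> //; left; [exists s|exists s'] => //.
  + move=> β β' a s s' /(wf_tm w1)[_ h1] /(wf_tr w2)[_ _ h2] h; split=> //.
      by left; exists s.
    by right; exists s'.
  + by move=> α a s s' /(wf_tr w2)[h h1 h']; split=> //; right; [exists s|exists s'].
- move=> α s []{α s}.
  + by move=> β β' s /(wf_tm w1)[_ h1] h2 h; split=> //; left; exists s.
  + by move=> α s /(wf_tm w2)[h h1]; split=> //; right; exists s.
- have /proper_setTP[x nx] := wf_proper w1; apply/proper_setTP; exists (inL x).
  by move=> [[x' + /inL_inj e]|[y' _ /esym/inLR//]]; rewrite e.
- have c1 s (h : st T1 s) := wf_branching w1 h; have c2 s (h : st T2 s) := wf_branching w2 h.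
  move=> s [[x Tx <-]|[x Tx <-]].
  + have c12 := card_ltX Kinf (c1 _ Tx) (c2 _ (wf_ini w2)).
    pose f (p : (B * A * S + B) * (B * A * S + B)) : B * A * S + B :=
      match p with
      | (inr β, inl (β', a, s')) => inl ((β `&` β')%O, a, inR s')
      | (inr β, inr β') => inr (β `&` β')%O
      | _ => inr \bot%O end.
    apply: card_lt_sub (card_lt_setU Kinf (card_lt_image (omap_out id inL) (c1 _ Tx))
       (card_lt_image f c12)).
    move=> [[[α a] s']|α] /=.
      move=> /seq_trL[[y -> h]|[β [β' [y [-> -> h h']]]]]; [left|right].
        by exists (inl (α, a, y)).
      by exists (inr β, inl (β', a, y)).
    by move=> /seq_tmL[β [β' [-> h h']]]; right; exists (inr β, inr β').
  + apply: card_lt_sub (card_lt_image (omap_out id inR) (c2 _ Tx)) => -[[[α a] s']|α] /=.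
      by move=> /seq_trR[y -> h]; exists (inl (α, a, y)).
    by move=> /seq_tmR h; exists (inr α).
Qed.
End SeqC.

Section GuardC.
Variables (φ : B) (T : cts).
Hypotheses (w : wf T).
Let S1 : set S := inL @` st T.
Let s0 := ch (~` S1).

Lemma guard_fresh : ~ S1 s0 /\ (s0 |` S1) `<` [set: S].
Proof.
have /proper_setTP[x nx] := wf_proper w.
apply: (@fresh _ (inL x) (inR x)); first exact: inLR.
  by move=> [x' + /inL_inj e]; rewrite e.
by move=> [x' _ /inLR].
Qed.

Lemma guard_s0 s : st T s -> s0 <> inL s.
Proof. by move=> h e; have [] := guard_fresh; rewrite e => H; case: H; exists s. Qed.

Lemma guard_tr0 α a s' : tr (guard_pre φ T) α a s0 s' ->
  exists β x, [/\ s' = inL x, α = (φ `&` β)%O & tr T β a (ini T) x].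
Proof.
move=> h; move: {-1}s0 (erefl s0) h => t et h.
case: h et => [β {}a x h _ _|{}α {}a s x h e].
- by exists β, x.
- by have [_ /guard_s0/(_ e)] := wf_tr w h.
Qed.

Lemma guard_trL α a s s' : st T s -> tr (guard_pre φ T) α a (inL s) s' ->
  exists2 x, s' = inL x & tr T α a s x.
Proof.
move=> Ss h; move: {-1}(inL s) (erefl (inL s)) h => t et h.
case: h et => [β {}a x h _ e|{}α {}a u x h e].
- by have := guard_s0 Ss; rewrite e.
- by exists x => //; rewrite (inL_inj e).
Qed.

Lemma guard_tm0 α : tm (guard_pre φ T) α s0 ->
  exists2 β, α = (φ `&` β)%O & tm T β (ini T).
Proof.
move=> h; move: {-1}s0 (erefl s0) h => t et h.
case: h et => [β h _ _|{}α s h e].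
- by exists β.
- by have [_ /guard_s0/(_ e)] := wf_tm w h.
Qed.

Lemma guard_tmL α s : st T s -> tm (guard_pre φ T) α (inL s) -> tm T α s.
Proof.
move=> Ss h; move: {-1}(inL s) (erefl (inL s)) h => t et h.
case: h et => [β h _ e|{}α u h e].
- by have := guard_s0 Ss; rewrite e.
- by rewrite (inL_inj e).
Qed.

Lemma wf_guard : wf (guard_pre φ T).
Proof.
split.
- by left.
- move=> α a s s' []{α a s s'}.
  + by move=> β a s' /(wf_tr w)[h _ h']; split=> //; [left|right; exists s'].
  + by move=> α a s s' /(wf_tr w)[h h1 h']; split=> //; right; [exists s|exists s'].
- move=> α s []{α s}.
  + by move=> β _ h; split=> //; left.
  + by move=> α s /(wf_tm w)[h h1]; split=> //; right; exists s.
- by have [] := guard_fresh.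
- have c1 f s (h : st T s) := card_lt_image (omap_out f inL) (wf_branching w h).
  move=> s [->|[x Tx <-]].
  + apply: card_lt_sub (c1 (Order.meet φ) _ (wf_ini w)).
    move=> [[[α a] s']|α] /=.
      by move=> /guard_tr0[β [x [-> -> h]]]; exists (inl (β, a, x)).
    by move=> /guard_tm0[β -> h]; exists (inr β).
  + apply: card_lt_sub (c1 id _ Tx) => -[[[α a] s']|α] /=.
      by move=> /(guard_trL Tx)[y -> h]; exists (inl (α, a, y)).
    by move=> /(guard_tmL Tx) h; exists (inr α).
Qed.
End GuardC.

Section ParC.
Variables T1 T2 : cts.
Hypotheses (w1 : wf T1) (w2 : wf T2).
Let s0 := ch (~` par_st T1 T2).

Lemma par_fresh : ~ par_st T1 T2 s0 /\ (s0 |` par_st T1 T2) `<` [set: S].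
Proof.
have /proper_setTP[x nx] := wf_proper w1; have /proper_setTP[y ny] := wf_proper w2.
apply: (@fresh _ (pr x y) (pr x (ini T2))).
- by move=> /pr_inj[_ e]; apply: ny; rewrite e; exact: wf_ini.
- by move=> [x' hx [y' hy /pr_inj[e e']]]; apply: nx; rewrite -e.
- by move=> [x' hx [y' hy /pr_inj[e e']]]; apply: nx; rewrite -e.
Qed.

Lemma par_s0 s t : st T1 s -> st T2 t -> s0 <> pr s t.
Proof.
by move=> h h' e; have [] := par_fresh; rewrite e => H; case: H; exists s => //; exists t.
Qed.

Lemma par_trE α a s t s' : par_tr gamma T1 T2 α a (pr s t) s' ->
  [\/ exists2 x, s' = pr x t & tr T1 α a s x,
      exists2 y, s' = pr s y & tr T2 α a t y |
      exists x y, s' = pr x y /\ sync gamma T1 T2 α a s t x y].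
Proof.
move=> h; move: {-1}(pr s t) (erefl (pr s t)) h => z ez h.
case: h ez => [{}α {}a x x' y h _|{}α {}a x y y' h _|{}α c x y x' y' h] /pr_inj[? ?]; subst.
- by constructor 1; exists x'.
- by constructor 2; exists y'.
- by constructor 3; exists x', y'.
Qed.

Lemma par_tmE α s t : par_tm T1 T2 α (pr s t) ->
  exists α' β', [/\ α = (α' `&` β')%O, tm T1 α' s & tm T2 β' t].
Proof.
move=> h; move: {-1}(pr s t) (erefl (pr s t)) h => z ez h.
case: h ez => [α' β' x y h h' _] /pr_inj[? ?]; subst.
by exists α', β'.
Qed.

Lemma sync_st α c s t s' t' : sync gamma T1 T2 α c s t s' t' ->
  [/\ α <> \bot%O, st T1 s, st T2 t, st T1 s' & st T2 t'].
Proof. by move=> [α' β' a b /(wf_tr w1)[_ ? ?] /(wf_tr w2)[_ ? ?]]. Qed.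

Lemma par_st_pr s t : st T1 s -> st T2 t -> par_st T1 T2 (pr s t).
Proof. by move=> h h'; exists s => //; exists t. Qed.

Lemma par_tr_st α a s s' : par_tr gamma T1 T2 α a s s' ->
  [/\ α <> \bot%O, par_st T1 T2 s & par_st T1 T2 s'].
Proof.
case=> {α a s s'}.
- by move=> α a s s' t /(wf_tr w1)[? ? ?] ?; split=> //; exact: par_st_pr.
- by move=> α a s t t' /(wf_tr w2)[? ? ?] ?; split=> //; exact: par_st_pr.
- by move=> α a s s' t t' /sync_st[? ? ? ? ?]; split=> //; exact: par_st_pr.
Qed.

Lemma par_tm_st α s : par_tm T1 T2 α s -> α <> \bot%O /\ par_st T1 T2 s.
Proof.
by case=> α' β' x y /(wf_tm w1)[_ ?] /(wf_tm w2)[_ ?] ?; split=> //; exact: par_st_pr.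
Qed.

Definition sync_out (p : (B * A * S + B) * (B * A * S + B)) : B * A * S + B :=
  match p with
  | (inl (α, a, x), inl (β, b, y)) =>
      if gamma (Some a) (Some b) is Some c then inl ((α `&` β)%O, c, pr x y)
      else inr \bot%O
  | (inr α, inr β) => inr (α `&` β)%O
  | _ => inr \bot%O end.

Lemma sync_outP α c s t x y : sync gamma T1 T2 α c s t x y ->
  (sync_out @` (out T1 s `*` out T2 t)) (inl (α, c, pr x y)).
Proof.
move=> [α' β' a b h h' e -> _].
by exists (inl (α', a, x), inl (β', b, y)) => //=; rewrite e.
Qed.

Lemma par_out_lt s : par_st T1 T2 s ->
  card_lt K [set x : B * A * S + B | match x with
    | inl (α, a, s') => par_tr gamma T1 T2 α a s s' | inr α => par_tm T1 T2 α s end].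
Proof.
move=> [x Tx [y Ty <-]].
have c1 := wf_branching w1 Tx; have c2 := wf_branching w2 Ty.
apply: card_lt_sub (card_lt_setU Kinf (card_lt_setU Kinf
  (card_lt_image (omap_out id (pr^~ y)) c1)
  (card_lt_image (omap_out id (pr x)) c2))
  (card_lt_image sync_out (card_ltX Kinf c1 c2))).
move=> [[[α a] s']|α] /=.
  move=> /par_trE[[x' -> h]|[y' -> h]|[x' [y' [-> h]]]].
  - by left; left; exists (inl (α, a, x')).
  - by left; right; exists (inl (α, a, y')).
  - by right; exact: sync_outP.
by move=> /par_tmE[α' [β' [-> h h']]]; right; exists (inr α', inr β').
Qed.

Lemma wf_par : wf (par_cts gamma T1 T2).
Proof.
split.
- by apply: par_st_pr; exact: wf_ini.
- exact: par_tr_st.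
- exact: par_tm_st.
- have [_ /proper_setTP[x nx]] := par_fresh; apply/proper_setTP; exists x => h.
  by apply: nx; right.
- exact: par_out_lt.
Qed.

Lemma reach_par : st T1 `<=` reach T1 -> st T2 `<=` reach T2 ->
  par_st T1 T2 `<=` reach (par_cts gamma T1 T2).
Proof.
move=> r1 r2 _ [x /r1 rx [y /r2 ry <-]].
have r0 : reach (par_cts gamma T1 T2) (pr x (ini T2)).
  elim: rx => [|α a s s' _ IH h]; first exact: (@reach_ini _ _ _ _ _ (par_cts gamma T1 T2)).
  by apply: reach_tr IH _; apply: par_left h _; exact: wf_ini.
elim: ry => [|α a s s' _ IH h]; first by [].
by apply: reach_tr IH _; apply: par_right h _; exact: wf_reach rx.
Qed.

Lemma lmerge_tr0 α a s' : tr (lmerge_pre gamma T1 T2) α a s0 s' ->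
  exists2 x, s' = pr x (ini T2) & tr T1 α a (ini T1) x.
Proof.
move=> h; move: {-1}s0 (erefl s0) h => t et h.
case: h et => [{}α {}a x h _|{}α {}a s s1 /par_tr_st[_ + _] e]; first by exists x.
by rewrite -e => /(par_fresh.1).
Qed.

Lemma lmerge_trE α a s t s' : st T1 s -> st T2 t ->
  tr (lmerge_pre gamma T1 T2) α a (pr s t) s' -> par_tr gamma T1 T2 α a (pr s t) s'.
Proof.
move=> Ss St h; move: {-1}(pr s t) (erefl (pr s t)) h => z ez h.
by case: h ez => [{}α {}a x h e|//]; case: (par_s0 Ss St); rewrite e.
Qed.

Lemma par_tm0 α : ~ par_tm T1 T2 α s0.
Proof. by move=> /par_tm_st[_ /(par_fresh.1)]. Qed.

Lemma cmerge_tr0 α a s' : tr (cmerge_pre gamma T1 T2) α a s0 s' ->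
  exists x y, s' = pr x y /\ sync gamma T1 T2 α a (ini T1) (ini T2) x y.
Proof.
move=> h; move: {-1}s0 (erefl s0) h => t et h.
case: h et => [{}α {}a x y h _|{}α {}a s s1 /par_tr_st[_ + _] e]; first by exists x, y.
by rewrite -e => /(par_fresh.1).
Qed.

Lemma cmerge_trE α a s t s' : st T1 s -> st T2 t ->
  tr (cmerge_pre gamma T1 T2) α a (pr s t) s' -> par_tr gamma T1 T2 α a (pr s t) s'.
Proof.
move=> Ss St h; move: {-1}(pr s t) (erefl (pr s t)) h => z ez h.
by case: h ez => [{}α {}a x y h e|//]; case: (par_s0 Ss St); rewrite e.
Qed.

Lemma wf_lmerge : wf (lmerge_pre gamma T1 T2).
Proof.
split.
- by left.
- move=> α a s s' []{α a s s'}.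
  + move=> α a s /(wf_tr w1)[h h1 h']; split=> //; first by left.
    by right; apply: par_st_pr => //; exact: wf_ini.
  + by move=> α a s s' /par_tr_st[? ? ?]; split=> //; right.
- by move=> α s /par_tm_st[? ?]; split=> //; right.
- by have [] := par_fresh.
- move=> s [->|sp].
  + apply: card_lt_sub (card_lt_image (omap_out id (pr^~ (ini T2)))
      (wf_branching w1 (wf_ini w1))) => -[[[α a] s']|α] /=.
      by move=> /lmerge_tr0[x -> h]; exists (inl (α, a, x)).
    by move=> /par_tm0.
  + apply: card_lt_sub (par_out_lt sp); case: sp => x Tx [y Ty <-].
    by move=> [[[α a] s']|α] //= /lmerge_trE; apply.
Qed.

Lemma wf_cmerge : wf (cmerge_pre gamma T1 T2).
Proof.
split.
- by left.
- move=> α a s s' []{α a s s'}.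
  + move=> α a s t /sync_st[? ? ? ? ?]; split=> //; first by left.
    by right; exact: par_st_pr.
  + by move=> α a s s' /par_tr_st[? ? ?]; split=> //; right.
- by move=> α s /par_tm_st[? ?]; split=> //; right.
- by have [] := par_fresh.
- move=> s [->|sp].
  + have cs := card_lt_image sync_out (card_ltX Kinf
      (wf_branching w1 (wf_ini w1)) (wf_branching w2 (wf_ini w2))).
    apply: card_lt_sub cs => -[[[α a] s']|α] /=.
      by move=> /cmerge_tr0[x [y [-> h]]]; exact: sync_outP.
    by move=> /par_tm0.
  + apply: card_lt_sub (par_out_lt sp); case: sp => x Tx [y Ty <-].
    by move=> [[[α a] s']|α] //= /cmerge_trE; apply.
Qed.
End ParC.

Lemma wf_encap H (T : cts) : wf T -> wf (encap_pre H T).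
Proof.
move=> w; split.
- exact: (wf_ini w).
- by move=> α a s s' [/(wf_tr w)[? ? ?] _].
- by move=> α s h; exact: (wf_tm w h).
- exact: (wf_proper w).
- move=> s Ts; apply: card_lt_sub (wf_branching w Ts).
  by move=> [[[α a] s']|α] //= [].
Qed.

Lemma leIim (α β u : B) : (α `&` β <= u)%O = (β <= ~` α `|` u)%O.
Proof. by rewrite -leBLR diffE complK meetC. Qed.

Lemma leI_nz (α β u : B) : ((α `&` β)%O <> \bot%O -> (α `&` β <= u)%O) ->
  (α `&` β <= u)%O.
Proof.
by move=> H; have [->|/eqP h] := eqVneq (α `&` β)%O \bot%O; [exact: le0x|exact: H].
Qed.

Definition rel_st (T U : cts) (R : S -> S -> Prop) :=
  forall s t, R s t -> st T s /\ st U t.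

Lemma rel_st_flip T U R : rel_st T U R -> rel_st U T (fun t s => R s t).
Proof. by move=> RS s t /RS[]. Qed.

Definition altR (T1 T2 U1 U2 : cts) (R1 R2 : S -> S -> Prop) (s t : S) : Prop :=
  [\/ s = ini (alt_pre T1 T2) /\ t = ini (alt_pre U1 U2),
      exists x y, [/\ s = inL x, t = inL y & R1 x y] |
      exists x y, [/\ s = inR x, t = inR y & R2 x y]].

Lemma alt_simB (T1 T2 U1 U2 : cts) R1 R2 :
  wf T1 -> wf T2 -> rel_st T1 U1 R1 -> rel_st T2 U2 R2 ->
  R1 (ini T1) (ini U1) -> R2 (ini T2) (ini U2) ->
  simB T1 U1 R1 -> simB T2 U2 R2 ->
  simB (alt_pre T1 T2) (alt_pre U1 U2) (altR T1 T2 U1 U2 R1 R2).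
Proof.
move=> w1 w2 S1 S2 i1 i2 H1 H2 s t [[-> ->]|[x [y [-> -> Rxy]]]|[x [y [-> -> Rxy]]]].
- have [Htr1 Htm1] := H1 _ _ i1; have [Htr2 Htm2] := H2 _ _ i2; split.
    move=> α a s' /(alt_tr0 w1 w2)[[z -> h]|[z -> h]] u hu.
      apply: Htr1 (h) _ _ => α' t' h1 h2; apply: (hu _ (inL t')).
        exact: alt_ini1.
      by constructor 2; exists z, t'.
    apply: Htr2 (h) _ _ => α' t' h1 h2; apply: (hu _ (inR t')).
      exact: alt_ini2.
    by constructor 3; exists z, t'.
  move=> α /(alt_tm0 w1 w2)[h|h] u hu.
    by apply: Htm1 (h) _ _ => α' h1; apply: hu; exact: alt_tm_ini1.
  by apply: Htm2 (h) _ _ => α' h1; apply: hu; exact: alt_tm_ini2.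
- have [Htr Htm] := H1 _ _ Rxy; have [Tx Uy] := S1 _ _ Rxy; split.
    move=> α a s' /(alt_trL w1 w2 Tx)[z -> h] u hu.
    apply: Htr (h) _ _ => α' t' h1 h2; apply: (hu _ (inL t')).
      exact: alt_in1.
    by constructor 2; exists z, t'.
  move=> α /(alt_tmL w1 w2 Tx) h u hu.
  by apply: Htm (h) _ _ => α' h1; apply: hu; exact: alt_tm_in1.
- have [Htr Htm] := H2 _ _ Rxy; have [Tx Uy] := S2 _ _ Rxy; split.
    move=> α a s' /(alt_trR w1 w2 Tx)[z -> h] u hu.
    apply: Htr (h) _ _ => α' t' h1 h2; apply: (hu _ (inR t')).
      exact: alt_in2.
    by constructor 3; exists z, t'.
  move=> α /(alt_tmR w1 w2 Tx) h u hu.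
  by apply: Htm (h) _ _ => α' h1; apply: hu; exact: alt_tm_in2.
Qed.

Lemma alt_cong (T1 T2 U1 U2 : Tk A B S) : split_bisim T1 U1 -> split_bisim T2 U2 ->
  split_bisim (alt_cts T1 T2) (alt_cts U1 U2).
Proof.
move=> /split_bisimP[R1 [S1 i1 H1 H1']] /split_bisimP[R2 [S2 i2 H2 H2']].
have := (sys_wf T1, sys_wf T2, sys_wf U1, sys_wf U2) => -[[[w1 w2] w3] w4].
apply: (@conn_bisim _ _ (altR T1 T2 U1 U2 R1 R2)).
- exact: wf_alt.
- exact: wf_alt.
- by constructor 1.
- exact: alt_simB.
- have := alt_simB w3 w4 (rel_st_flip S1) (rel_st_flip S2) i1 i2 H1' H2'.
  apply: simB_flip => s t.
  by split=> -[[-> ->]|[x [y [-> -> r]]]|[x [y [-> -> r]]]];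
    [constructor 1|constructor 2; exists y, x|constructor 3; exists y, x|
     constructor 1|constructor 2; exists y, x|constructor 3; exists y, x].
Qed.

Definition seqR (R1 R2 : S -> S -> Prop) (s t : S) : Prop :=
  (exists x y, [/\ s = inL x, t = inL y & R1 x y]) \/
  (exists x y, [/\ s = inR x, t = inR y & R2 x y]).

Lemma seqR_flip R1 R2 s t :
  seqR (fun t s => R1 s t) (fun t s => R2 s t) t s <-> seqR R1 R2 s t.
Proof.
by split=> -[[x [y [-> -> r]]]|[x [y [-> -> r]]]];
    [left; exists y, x|right; exists y, x|left; exists y, x|right; exists y, x].
Qed.

Lemma seq_simB (T1 T2 U1 U2 : cts) R1 R2 :
  R2 (ini T2) (ini U2) -> simB T1 U1 R1 -> simB T2 U2 R2 ->
  simB (seq_pre T1 T2) (seq_pre U1 U2) (seqR R1 R2).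
Proof.
move=> i2 H1 H2 s t [[x [y [-> -> Rxy]]]|[x [y [-> -> Rxy]]]].
- have [Htr Htm] := H1 _ _ Rxy; have [Htr2 Htm2] := H2 _ _ i2; split.
    move=> α a s' /seq_trL[[z -> h]|[β [β' [z [-> -> h h']]]]] u hu.
      apply: Htr (h) _ _ => α' t' h1 h2; apply: (hu _ (inL t')).
        exact: seq_in1.
      by left; exists z, t'.
    rewrite meetC leIim; apply: Htm (h) _ _ => γ hγ; rewrite -leIim meetC leIim.
    apply: Htr2 (h') _ _ => γ' t' h1 h2; rewrite -leIim; apply: leI_nz => nz.
    apply: (hu _ (inR t')); first exact: seq_pass.
    by right; exists z, t'.
  move=> α /seq_tmL[β [β' [-> h h']]] u hu.
  rewrite meetC leIim; apply: Htm (h) _ _ => γ hγ; rewrite -leIim meetC leIim.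
  apply: Htm2 (h') _ _ => γ' h1; rewrite -leIim; apply: leI_nz => nz.
  by apply: hu; exact: seq_tm_pass.
- have [Htr Htm] := H2 _ _ Rxy; split.
    move=> α a s' /seq_trR[z -> h] u hu.
    apply: Htr (h) _ _ => α' t' h1 h2; apply: (hu _ (inR t')).
      exact: seq_in2.
    by right; exists z, t'.
  move=> α /seq_tmR h u hu.
  by apply: Htm (h) _ _ => α' h1; apply: hu; exact: seq_tm_in2.
Qed.

Lemma seq_cong (T1 T2 U1 U2 : Tk A B S) : split_bisim T1 U1 -> split_bisim T2 U2 ->
  split_bisim (seq_cts T1 T2) (seq_cts U1 U2).
Proof.
move=> /split_bisimP[R1 [S1 i1 H1 H1']] /split_bisimP[R2 [S2 i2 H2 H2']].
have := (sys_wf T1, sys_wf T2, sys_wf U1, sys_wf U2) => -[[[w1 w2] w3] w4].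
apply: (@conn_bisim _ _ (seqR R1 R2)).
- exact: wf_seq.
- exact: wf_seq.
- by left; exists (ini T1), (ini U1).
- exact: seq_simB.
- by have := seq_simB i2 H1' H2'; apply: simB_flip => s t; exact: seqR_flip.
Qed.

Definition guardR (φ : B) (T U : cts) (R : S -> S -> Prop) (s t : S) : Prop :=
  (s = ini (guard_pre φ T) /\ t = ini (guard_pre φ U)) \/
  (exists x y, [/\ s = inL x, t = inL y & R x y]).

Lemma guard_simB φ (T U : cts) R : wf T -> rel_st T U R ->
  R (ini T) (ini U) -> simB T U R ->
  simB (guard_pre φ T) (guard_pre φ U) (guardR φ T U R).
Proof.
move=> w1 S1 i1 H1 s t [[-> ->]|[x [y [-> -> Rxy]]]].
- have [Htr Htm] := H1 _ _ i1; split.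
    move=> α a s' /(guard_tr0 w1)[β [z [-> -> h]]] u hu.
    rewrite leIim; apply: Htr (h) _ _ => β' t' h1 h2; rewrite -leIim.
    apply: leI_nz => nz; apply: (hu _ (inL t')); first exact: guard_ini.
    by right; exists z, t'.
  move=> α /(guard_tm0 w1)[β -> h] u hu.
  rewrite leIim; apply: Htm (h) _ _ => β' h1; rewrite -leIim.
  by apply: leI_nz => nz; apply: hu; exact: guard_tm_ini.
- have [Htr Htm] := H1 _ _ Rxy; have [Tx Uy] := S1 _ _ Rxy; split.
    move=> α a s' /(guard_trL w1 Tx)[z -> h] u hu.
    apply: Htr (h) _ _ => α' t' h1 h2; apply: (hu _ (inL t')).
      exact: guard_in.
    by right; exists z, t'.
  move=> α /(guard_tmL w1 Tx) h u hu.
  by apply: Htm (h) _ _ => α' h1; apply: hu; exact: guard_tm_in.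
Qed.

Lemma guard_cong φ (T U : Tk A B S) : split_bisim T U ->
  split_bisim (guard_cts φ T) (guard_cts φ U).
Proof.
move=> /split_bisimP[R1 [S1 i1 H1 H1']].
have w1 := sys_wf T; have w3 := sys_wf U.
apply: (@conn_bisim _ _ (guardR φ T U R1)).
- exact: wf_guard.
- exact: wf_guard.
- by left.
- exact: guard_simB.
- have := guard_simB (φ := φ) w3 (rel_st_flip S1) i1 H1'.
  apply: simB_flip => s t.
  by split=> -[[-> ->]|[x [y [-> -> r]]]]; [left|right; exists y, x|left|right; exists y, x].
Qed.

Definition parR (R1 R2 : S -> S -> Prop) (s t : S) : Prop :=
  exists x x' y y', [/\ s = pr x x', t = pr y y', R1 x y & R2 x' y'].

Lemma parR_flip R1 R2 s t :
  parR (fun t s => R1 s t) (fun t s => R2 s t) t s <-> parR R1 R2 s t.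
Proof. by split=> -[x [x' [y [y' [-> -> ? ?]]]]]; exists y, y', x, x'. Qed.

Lemma sync_simB (T1 T2 U1 U2 : cts) (R1 R2 : S -> S -> Prop) α c x x' z z' y y' (u : B) :
  simB T1 U1 R1 -> simB T2 U2 R2 -> R1 x y -> R2 x' y' ->
  sync gamma T1 T2 α c x x' z z' ->
  (forall α' t t', sync gamma U1 U2 α' c y y' t t' -> R1 z t -> R2 z' t' -> (α' <= u)%O) ->
  (α <= u)%O.
Proof.
move=> H1 H2 /H1[Htr1 _] /H2[Htr2 _] [β β' a b h h' e -> _] hu.
rewrite meetC leIim; apply: Htr1 (h) _ _ => γ t hγ r1; rewrite -leIim meetC leIim.
apply: Htr2 (h') _ _ => γ' t' hγ' r2; rewrite -leIim; apply: leI_nz => nz.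
by apply: (hu _ t t') => //; exists γ γ' a b.
Qed.

Lemma par_simB (T1 T2 U1 U2 : cts) R1 R2 :
  rel_st T1 U1 R1 -> rel_st T2 U2 R2 ->
  simB T1 U1 R1 -> simB T2 U2 R2 ->
  simB (par_cts gamma T1 T2) (par_cts gamma U1 U2) (parR R1 R2).
Proof.
move=> S1 S2 H1 H2 s t [x [x' [y [y' [-> -> r1 r2]]]]].
have [Htr1 Htm1] := H1 _ _ r1; have [Htr2 Htm2] := H2 _ _ r2.
have [Sx Sy] := S1 _ _ r1; have [Sx' Sy'] := S2 _ _ r2; split.
  move=> α a s' /par_trE[[z -> h]|[z -> h]|[z [z' [-> h]]]] u hu.
  - apply: Htr1 (h) _ _ => α' t' h1 h2; apply: (hu _ (pr t' y')).
      exact: par_left.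
    by exists z, x', t', y'.
  - apply: Htr2 (h) _ _ => α' t' h1 h2; apply: (hu _ (pr y t')).
      exact: par_right.
    by exists x, z, y, t'.
  - apply: (sync_simB H1 H2 r1 r2 h) => α' t1 t2 h1 q1 q2; apply: (hu _ (pr t1 t2)).
      exact: par_sync.
    by exists z, z', t1, t2.
move=> α /par_tmE[β [β' [-> h h']]] u hu.
rewrite meetC leIim; apply: Htm1 (h) _ _ => γ hγ; rewrite -leIim meetC leIim.
apply: Htm2 (h') _ _ => γ' h1; rewrite -leIim; apply: leI_nz => nz.
by apply: hu; exact: Par_tm.
Qed.

Lemma par_cong (T1 T2 U1 U2 : Tk A B S) : split_bisim T1 U1 -> split_bisim T2 U2 ->
  split_bisim (par_cts gamma T1 T2) (par_cts gamma U1 U2).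
Proof.
move=> /split_bisimP[R1 [S1 i1 H1 H1']] /split_bisimP[R2 [S2 i2 H2 H2']].
have := (sys_wf T1, sys_wf T2, sys_wf U1, sys_wf U2) => -[[[w1 w2] w3] w4].
apply: (@simBP _ _ (parR R1 R2)).
- exact: wf_par.
- exact: wf_par.
- by exists (ini T1), (ini T2), (ini U1), (ini U2).
- exact: par_simB.
- have := par_simB (rel_st_flip S1) (rel_st_flip S2) H1' H2'.
  by apply: simB_flip => s t; exact: parR_flip.
Qed.

Definition mergeR (T1 T2 U1 U2 : cts) (R1 R2 : S -> S -> Prop) (s t : S) : Prop :=
  (s = ch (~` par_st T1 T2) /\ t = ch (~` par_st U1 U2)) \/ parR R1 R2 s t.

Lemma mergeR_flip (T1 T2 U1 U2 : cts) R1 R2 s t :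
  mergeR U1 U2 T1 T2 (fun t s => R1 s t) (fun t s => R2 s t) t s <->
  mergeR T1 T2 U1 U2 R1 R2 s t.
Proof.
by have [h1 h2] := parR_flip R1 R2 s t; split=> -[[-> ->]|h];
  [left|right; exact: h1|left|right; exact: h2].
Qed.

Lemma lmerge_simB (T1 T2 U1 U2 : cts) R1 R2 :
  wf T1 -> wf T2 -> rel_st T1 U1 R1 -> rel_st T2 U2 R2 ->
  R1 (ini T1) (ini U1) -> R2 (ini T2) (ini U2) ->
  simB T1 U1 R1 -> simB T2 U2 R2 ->
  simB (lmerge_pre gamma T1 T2) (lmerge_pre gamma U1 U2) (mergeR T1 T2 U1 U2 R1 R2).
Proof.
move=> w1 w2 S1 S2 i1 i2 H1 H2 s t [[-> ->]|r].
  split; last by move=> α /(par_tm0 w1 w2).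
  have [Htr _] := H1 _ _ i1.
  move=> α a s' /(lmerge_tr0 w1 w2)[z -> h] u hu.
  apply: Htr (h) _ _ => α' t' h1 h2; apply: (hu _ (pr t' (ini U2))).
    exact: lmerge_ini.
  by right; exists z, (ini T2), t', (ini U2).
have [Htr Htm] := par_simB S1 S2 H1 H2 r; split=> // α a s' h u hu.
have {}h : par_tr gamma T1 T2 α a s s'.
  case: r h => x [x' [y [y' [-> _ /S1[Tx _] /S2[Tx' _]]]]].
  exact: lmerge_trE.
apply: Htr (h) _ _ => α' t' h1 h2; apply: hu (lmerge_in h1) _.
by right.
Qed.

Lemma lmerge_cong (T1 T2 U1 U2 : Tk A B S) : split_bisim T1 U1 -> split_bisim T2 U2 ->
  split_bisim (lmerge_cts gamma T1 T2) (lmerge_cts gamma U1 U2).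
Proof.
move=> /split_bisimP[R1 [S1 i1 H1 H1']] /split_bisimP[R2 [S2 i2 H2 H2']].
have := (sys_wf T1, sys_wf T2, sys_wf U1, sys_wf U2) => -[[[w1 w2] w3] w4].
apply: (@conn_bisim _ _ (mergeR T1 T2 U1 U2 R1 R2)).
- exact: wf_lmerge.
- exact: wf_lmerge.
- by left.
- exact: lmerge_simB.
- have := lmerge_simB w3 w4 (rel_st_flip S1) (rel_st_flip S2) i1 i2 H1' H2'.
  by apply: simB_flip => s t; exact: mergeR_flip.
Qed.

Lemma cmerge_simB (T1 T2 U1 U2 : cts) R1 R2 :
  wf T1 -> wf T2 -> rel_st T1 U1 R1 -> rel_st T2 U2 R2 ->
  R1 (ini T1) (ini U1) -> R2 (ini T2) (ini U2) ->
  simB T1 U1 R1 -> simB T2 U2 R2 ->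
  simB (cmerge_pre gamma T1 T2) (cmerge_pre gamma U1 U2) (mergeR T1 T2 U1 U2 R1 R2).
Proof.
move=> w1 w2 S1 S2 i1 i2 H1 H2 s t [[-> ->]|r].
  split; last by move=> α /(par_tm0 w1 w2).
  move=> α a s' /(cmerge_tr0 w1 w2)[z [z' [-> h]]] u hu.
  apply: (sync_simB H1 H2 i1 i2 h) => α' t1 t2 h1 q1 q2; apply: (hu _ (pr t1 t2)).
    exact: cmerge_ini.
  by right; exists z, z', t1, t2.
have [Htr Htm] := par_simB S1 S2 H1 H2 r; split=> // α a s' h u hu.
have {}h : par_tr gamma T1 T2 α a s s'.
  case: r h => x [x' [y [y' [-> _ /S1[Tx _] /S2[Tx' _]]]]].
  exact: cmerge_trE.
apply: Htr (h) _ _ => α' t' h1 h2; apply: hu (cmerge_in h1) _.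
by right.
Qed.

Lemma cmerge_cong (T1 T2 U1 U2 : Tk A B S) : split_bisim T1 U1 -> split_bisim T2 U2 ->
  split_bisim (cmerge_cts gamma T1 T2) (cmerge_cts gamma U1 U2).
Proof.
move=> /split_bisimP[R1 [S1 i1 H1 H1']] /split_bisimP[R2 [S2 i2 H2 H2']].
have := (sys_wf T1, sys_wf T2, sys_wf U1, sys_wf U2) => -[[[w1 w2] w3] w4].
apply: (@conn_bisim _ _ (mergeR T1 T2 U1 U2 R1 R2)).
- exact: wf_cmerge.
- exact: wf_cmerge.
- by left.
- exact: cmerge_simB.
- have := cmerge_simB w3 w4 (rel_st_flip S1) (rel_st_flip S2) i1 i2 H1' H2'.
  by apply: simB_flip => s t; exact: mergeR_flip.
Qed.

Lemma encap_simB H (T U : cts) R : simB T U R ->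
  simB (encap_pre H T) (encap_pre H U) R.
Proof.
move=> H1 s t /H1[Htr Htm]; split=> // α a s' [h aH] u hu.
by apply: Htr (h) _ _ => α' t' h1 h2; apply: (hu _ t').
Qed.

Lemma encap_cong H (T U : Tk A B S) : split_bisim T U ->
  split_bisim (encap_cts H T) (encap_cts H U).
Proof.
move=> /split_bisimP[R1 [S1 i1 H1 H1']].
apply: (@conn_bisim _ _ R1) => //; try exact: wf_encap (sys_wf _).
  exact: encap_simB.
exact: encap_simB H1'.
Qed.

Definition alt_Tk (T1 T2 : Tk A B S) : Tk A B S :=
  conn_Tk (wf_alt (sys_wf T1) (sys_wf T2)).
Definition seq_Tk (T1 T2 : Tk A B S) : Tk A B S :=
  conn_Tk (wf_seq (sys_wf T1) (sys_wf T2)).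
Definition par_Tk (T1 T2 : Tk A B S) : Tk A B S :=
  MkTk (wf_par (sys_wf T1) (sys_wf T2))
       (reach_par (sys_wf T1) (sys_wf T2) (@sys_conn _ _ _ _ _ T1) (@sys_conn _ _ _ _ _ T2)).
Definition lmerge_Tk (T1 T2 : Tk A B S) : Tk A B S :=
  conn_Tk (wf_lmerge (sys_wf T1) (sys_wf T2)).
Definition cmerge_Tk (T1 T2 : Tk A B S) : Tk A B S :=
  conn_Tk (wf_cmerge (sys_wf T1) (sys_wf T2)).
Definition guard_Tk (α : B) (T : Tk A B S) : Tk A B S :=
  conn_Tk (wf_guard α (sys_wf T)).
Definition encap_Tk (H : {set A}) (T : Tk A B S) : Tk A B S :=
  conn_Tk (wf_encap H (sys_wf T)).

Lemma split_bisimb_refl : reflexive (@split_bisimb A K d B S).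
Proof. by move=> T; apply/asboolP; exact: split_bisim_refl. Qed.

Lemma split_bisimb_sym : symmetric (@split_bisimb A K d B S).
Proof. by move=> T U; apply/asboolP/asboolP; exact: split_bisim_sym. Qed.

Lemma split_bisimb_trans : transitive (@split_bisimb A K d B S).
Proof.
by move=> T2 T1 T3 /asboolP h /asboolP h'; apply/asboolP; exact: split_bisim_trans h h'.
Qed.

Canonical split_bisim_equiv :=
  EquivRel (@split_bisimb A K d B S) split_bisimb_refl split_bisimb_sym split_bisimb_trans.

Definition Mproc : Type := {eq_quot split_bisim_equiv}%qT.
Definition cls (T : Tk A B S) : Mproc := (\pi T)%qT.
Definition rep (x : Mproc) : Tk A B S := repr x.

Lemma cls_eq (T U : Tk A B S) : cls T = cls U <-> split_bisim T U.
Proof.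
by split=> [/eqquotP/asboolP|h]; last apply/eqquotP/asboolP.
Qed.

Lemma rep_cls (T : Tk A B S) : split_bisim (rep (cls T)) T.
Proof. by apply/cls_eq; rewrite /cls /rep reprK. Qed.

(** Operations on classes are computed on representatives; the lemmas [MaltE] to
    [MencapE] below show that the result is the class of the operation on any
    representatives. *)
Definition Malt (x y : Mproc) : Mproc := cls (alt_Tk (rep x) (rep y)).
Definition Mseq (x y : Mproc) : Mproc := cls (seq_Tk (rep x) (rep y)).
Definition Mpar (x y : Mproc) : Mproc := cls (par_Tk (rep x) (rep y)).
Definition Mlmerge (x y : Mproc) : Mproc := cls (lmerge_Tk (rep x) (rep y)).
Definition Mcmerge (x y : Mproc) : Mproc := cls (cmerge_Tk (rep x) (rep y)).
Definition Mguard (α : B) (x : Mproc) : Mproc := cls (guard_Tk α (rep x)).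
Definition Mencap (H : {set A}) (x : Mproc) : Mproc := cls (encap_Tk H (rep x)).

Lemma MaltE T U : Malt (cls T) (cls U) = cls (alt_Tk T U).
Proof. by apply/cls_eq/alt_cong; exact: rep_cls. Qed.
Lemma MseqE T U : Mseq (cls T) (cls U) = cls (seq_Tk T U).
Proof. by apply/cls_eq/seq_cong; exact: rep_cls. Qed.
Lemma MparE T U : Mpar (cls T) (cls U) = cls (par_Tk T U).
Proof. by apply/cls_eq/par_cong; exact: rep_cls. Qed.
Lemma MlmergeE T U : Mlmerge (cls T) (cls U) = cls (lmerge_Tk T U).
Proof. by apply/cls_eq/lmerge_cong; exact: rep_cls. Qed.
Lemma McmergeE T U : Mcmerge (cls T) (cls U) = cls (cmerge_Tk T U).
Proof. by apply/cls_eq/cmerge_cong; exact: rep_cls. Qed.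
Lemma MguardE α T : Mguard α (cls T) = cls (guard_Tk α T).
Proof. by apply/cls_eq/guard_cong; exact: rep_cls. Qed.
Lemma MencapE H T : Mencap H (cls T) = cls (encap_Tk H T).
Proof. by apply/cls_eq/encap_cong; exact: rep_cls. Qed.

Definition Mk : acpc_structure A C := {|
  Proc := Mproc;
  Cond := B;
  delta := cls delta_Tk;
  eps := cls eps_Tk;
  act a := cls (act_Tk a);
  alt := Malt;
  seqc := Mseq;
  par := Mpar;
  lmerge := Mlmerge;
  cmerge := Mcmerge;
  guard := Mguard;
  encap := Mencap;
  cbot := \bot%O;
  ctop := \top%O;
  catom := gen;
  cneg := fun φ => (~` φ)%O;
  cjoin := fun φ ψ => (φ `|` ψ)%O;
  cmeet := fun φ ψ => (φ `&` ψ)%O |}.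
End Closure.

(* Main.v *)
Require Import Defs.
From mathcomp Require Import all_boot all_order.
From mathcomp Require Import boolp classical_sets functions cardinality.

(** The argument goes through structural operational semantics. Process terms
    over the states of arbitrary systems form one large transition system, in
    which alternative composition, guarding, left merge and communication merge
    only act on the first step, so that most axioms relate terms having the same
    first steps; the others are proved by coinduction. Each operation on
    systems is splitting bisimilar to the corresponding operator on terms, which
    transfers the laws to the quotient model. *)

Set Implicit Arguments.
Unset Strict Implicit.
Unset Printing Implicit Defensive.
Import Order.TTheory Order.CTheory.

(** Each operation on systems encodes its states by injections, pairings and freshly chosen points
    and then restricts to the reachable part, so relating the two sides of an axiom directly would
    mean comparing nested encodings. On terms the residual of a step is again a term, and each
    operation has to be decoded only once. Splitting is the second obstacle: one transition may be
    answered by several whose labels jointly dominate it, and terms have no branching bound that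
    would keep the family of answers small or make its supremum available. Hence domination is
    phrased through upper bounds, with no bound on the size of the family; on systems the
    cardinality condition is recovered from the branching degree. Labels equal to [\bot], which
    systems discard, do no harm on terms because the empty family already dominates them; this
    spares side conditions in the rules for sequencing, communication and guards. *)

(** * Domination of a condition by a family of conditions *)

Section Cover.
Variables (d : Order.disp_t) (B : ctbDistrLatticeType d).

(** [α] lies below the supremum of [X], stated without assuming that this
    supremum exists. *)
Definition cover (X : B -> Prop) (α : B) : Prop :=
  forall u : B, (forall α', X α' -> (α' <= u)%O) -> (α <= u)%O.

Lemma cover_le (X : B -> Prop) α α' : X α' -> (α <= α')%O -> cover X α.
Proof. by move=> Xα' le u; move/(_ _ Xα'); exact: le_trans. Qed.

Lemma cover_id (X : B -> Prop) α : X α -> cover X α.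
Proof. by move=> Xα u; apply. Qed.

Lemma cover_bind (X Y : B -> Prop) α :
  cover X α -> (forall α', X α' -> cover Y α') -> cover Y α.
Proof. by move=> cX XY u hu; apply: cX => α' /XY; apply. Qed.

Lemma cover_sub (X Y : B -> Prop) α :
  cover X α -> (forall α', X α' -> Y α') -> cover Y α.
Proof. by move=> cX XY u hu; apply: cX => α' /XY; exact: hu. Qed.

(** [\bot] lies below every upper bound, so it is covered even by the empty family. *)
Lemma cover_nonbot (X : B -> Prop) α : (α <> \bot%O -> cover X α) -> cover X α.
Proof.
move=> cX; have [->|/eqP/cX//] := eqVneq α \bot%O.
by move=> u _; exact: le0x.
Qed.

(** A finite meet distributes over covers of any size because it has a residual: [leIim] moves one
    factor to the right of the inequality while the cover of the other is applied. *)
Lemma cover_meet (X Y Z : B -> Prop) α β : cover X α -> cover Y β ->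
  (forall α' β', X α' -> Y β' -> Z (α' `&` β')%O) -> cover Z (α `&` β)%O.
Proof.
move=> cX cY XYZ u hu; rewrite meetC leIim; apply: cX => α' Xα'.
rewrite -leIim meetC leIim; apply: cY => β' Yβ'.
by rewrite -leIim; apply: hu; exact: XYZ.
Qed.
End Cover.

(** * Process terms and their operational semantics *)

Section Terms.
Variables (A : finType) (gamma : option A -> option A -> option A).
Variables (K : Type) (d : Order.disp_t) (B : ctbDistrLatticeType d).
Variable (S : state_universe K).
Local Notation cts := (cts A B S).

Inductive term : Type :=
| St (T : cts) (s : S)
| Dlt
| Eps
| Act (a : A)
| Alt (p q : term)
| Seq (p q : term)
| Par (p q : term)
| Lmerge (p q : term)
| Cmerge (p q : term)
| Guard (φ : B) (p : term)
| Encap (H : {set A}) (p : term).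

(** The arguments are step relations rather than terms, so that [step] can use it within its own
    structural recursion. *)
Definition comm (X Y : B -> A -> term -> Prop) α c r : Prop :=
  exists β β' a b p q, [/\ X β a p, Y β' b q, gamma (Some a) (Some b) = Some c,
    α = (β `&` β')%O & r = Par p q].

Fixpoint term_tm (p : term) (α : B) : Prop :=
  match p with
  | St T s => tm T α s
  | Eps => α = \top%O
  | Alt p q => term_tm p α \/ term_tm q α
  | Seq p q | Par p q =>
      exists β β', [/\ term_tm p β, term_tm q β' & α = (β `&` β')%O]
  | Guard φ p => exists2 β, term_tm p β & α = (φ `&` β)%O
  | Encap _ p => term_tm p α
  | _ => False
  end.

(** Labels may be [\bot]: a covering condition holds trivially for them. *)
Fixpoint step (p : term) (α : B) (a : A) (r : term) {struct p} : Prop :=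
  match p with
  | St T s => exists2 s', tr T α a s s' & r = St T s'
  | Dlt | Eps => False
  | Act b => [/\ α = \top%O, a = b & r = Eps]
  | Alt p q => step p α a r \/ step q α a r
  | Seq p q => (exists2 p', step p α a p' & r = Seq p' q) \/
      (exists β β', [/\ term_tm p β, step q β' a r & α = (β `&` β')%O])
  | Par p q => [\/ exists2 p', step p α a p' & r = Par p' q,
      exists2 q', step q α a q' & r = Par p q' |
      comm (step p) (step q) α a r]
  | Lmerge p q => exists2 p', step p α a p' & r = Par p' q
  | Cmerge p q => comm (step p) (step q) α a r
  | Guard φ p => exists2 β, step p β a r & α = (φ `&` β)%O
  | Encap H p => exists2 p', step p α a p' & r = Encap H p' /\ a \notin H
  end.

(** * Splitting bisimilarity of terms and coinduction principles *)

Definition sim_at (R : term -> term -> Prop) (p q : term) : Prop :=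
  (forall α a p', step p α a p' ->
     cover (fun α' => exists2 q', step q α' a q' & R p' q') α) /\
  (forall α, term_tm p α -> cover (term_tm q) α).

Definition bis (p q : term) : Prop := exists2 R : term -> term -> Prop, R p q &
  forall p q, R p q -> sim_at R p q /\ sim_at (fun q p => R p q) q p.

Lemma sim_at_mono (R R' : term -> term -> Prop) p q :
  (forall p q, R p q -> R' p q) -> sim_at R p q -> sim_at R' p q.
Proof.
move=> RR' [Hs Ht]; split=> // α a p' /Hs h.
by apply: cover_sub h _ => α' [q' h1 h2]; exists q' => //; exact: RR'.
Qed.

Lemma bis_sim p q : bis p q -> sim_at bis p q.
Proof. by move=> [R Rpq /[dup] RB /(_ _ _ Rpq)[+ _]]; apply: sim_at_mono => ? ?; exists R. Qed.

Lemma bis_sym p q : bis p q -> bis q p.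
Proof. by move=> [R Rpq RB]; exists (fun q p => R p q) => // q' p' /RB[]. Qed.

(** Coinduction up to known bisimilarity: the union of [R] and [bis] is a bisimulation, as [bis]
    already matches its own steps. Residuals settled by reflexivity or an earlier law thus need not
    be put into [R]. *)
Lemma bis_coind (R : term -> term -> Prop) p q : R p q ->
  (forall p q, R p q -> sim_at (fun p q => R p q \/ bis p q) p q /\
                        sim_at (fun q p => R p q \/ bis p q) q p) ->
  bis p q.
Proof.
move=> Rpq RB; exists (fun p q => R p q \/ bis p q); first by left.
move=> p1 q1 [/RB//|pq]; split.
  by apply: sim_at_mono (bis_sim pq) => ? ?; right.
by apply: sim_at_mono (bis_sim (bis_sym pq)) => ? ? /bis_sym; right.
Qed.

Lemma bis_coind_sym (R : term -> term -> Prop) p q : R p q ->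
  (forall p q, R p q -> R q p) ->
  (forall p q, R p q -> sim_at (fun p q => R p q \/ bis p q) p q) -> bis p q.
Proof.
move=> Rpq Rsym RB; apply: bis_coind Rpq _ => p1 q1 Rpq1; split; first exact: RB.
by apply: sim_at_mono (RB _ _ (Rsym _ _ Rpq1)) => ? ? [/Rsym|/bis_sym]; [left|right].
Qed.

(** With residuals absorbed by [bis], the single pair is enough as relation; this serves the
    operators that vanish after the first step. *)
Lemma bis_intro p q : sim_at bis p q -> sim_at bis q p -> bis p q.
Proof.
move=> pq qp; apply: (@bis_coind (fun p' q' => p' = p /\ q' = q)) => // _ _ [-> ->].
split; first by apply: sim_at_mono pq => ? ?; right.
by apply: sim_at_mono qp => ? ? /bis_sym; right.
Qed.

Lemma bis_refl p : bis p p.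
Proof.
exists eq => // p1 _ <-.
by split; split=> [α a p' h|α h]; apply: cover_id => //; exists p'.
Qed.

Lemma sim_at_trans R R' p q r : sim_at R p q -> sim_at R' q r ->
  sim_at (fun p r => exists2 q, R p q & R' q r) p r.
Proof.
move=> [Hs Ht] [Hs' Ht']; split=> [α a p' /Hs|α /Ht] h; apply: cover_bind h _ => α'.
  move=> [q' /Hs' h1 h2]; apply: cover_sub h1 _ => α'' [r' h3 h4].
  by exists r' => //; exists q'.
exact: Ht'.
Qed.

Lemma bis_trans q p r : bis p q -> bis q r -> bis p r.
Proof.
move=> pq qr.
apply: (@bis_coind (fun p r => exists2 q, bis p q & bis q r)); first by exists q.
move=> p1 r1 [q1 {}pq {}qr]; split.
  by apply: sim_at_mono (sim_at_trans (bis_sim pq) (bis_sim qr)); left.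
apply: sim_at_mono (sim_at_trans (bis_sim (bis_sym qr)) (bis_sim (bis_sym pq))).
by move=> p' r' [q' /bis_sym h /bis_sym h']; left; exists q'.
Qed.

(** Residuals are compared by equality, so only the labels can differ between the two sides. *)
Definition sub_at (p q : term) : Prop :=
  (forall α a r, step p α a r -> cover (fun α' => step q α' a r) α) /\
  (forall α, term_tm p α -> cover (term_tm q) α).

Lemma sub_at_sim p q : sub_at p q -> sim_at bis p q.
Proof.
move=> [Hs Ht]; split=> // α a r /Hs h.
by apply: cover_sub h _ => α' h; exists r => //; exact: bis_refl.
Qed.

Lemma bis_sub p q : sub_at p q -> sub_at q p -> bis p q.
Proof. by move=> /sub_at_sim h /sub_at_sim; exact: bis_intro. Qed.

Lemma bis_ext p q : (forall α a r, step p α a r <-> step q α a r) ->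
  (forall α, term_tm p α <-> term_tm q α) -> bis p q.
Proof.
by move=> Hs Ht; apply: bis_sub; split=> [α a r /Hs h|α /Ht h]; apply: cover_id.
Qed.

(** * Congruence of bisimilarity for the operators on terms *)

Lemma bis_Alt p p' q q' : bis p p' -> bis q q' -> bis (Alt p q) (Alt p' q').
Proof.
have H p1 p1' q1 q1' : bis p1 p1' -> bis q1 q1' -> sim_at bis (Alt p1 q1) (Alt p1' q1').
  move=> /bis_sim[Hs Ht] /bis_sim[Hs' Ht']; split.
    by move=> α a r /= [/Hs|/Hs'] h; apply: cover_sub h _ => α' [r' ? ?];
      exists r' => //; [left|right].
  by move=> α /= [/Ht|/Ht'] h; apply: cover_sub h _ => α' ?; [left|right].
by move=> h h'; apply: bis_intro; apply: H => //; exact: bis_sym.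
Qed.

Lemma bis_Guard φ p p' : bis p p' -> bis (Guard φ p) (Guard φ p').
Proof.
have H p1 p1' : bis p1 p1' -> sim_at bis (Guard φ p1) (Guard φ p1').
  move=> /bis_sim[Hs Ht]; split.
    move=> _ a r /= [β /Hs h ->]; apply: (cover_meet (cover_id (X := eq φ) erefl) h).
    by move=> _ β' <- [r' ? ?]; exists r' => //; exists β'.
  move=> _ /= [β /Ht h ->]; apply: (cover_meet (cover_id (X := eq φ) erefl) h).
  by move=> _ β' <- ?; exists β'.
by move=> h; apply: bis_intro; apply: H => //; exact: bis_sym.
Qed.

(** The two components answer independently, each by a family; all pairs of answers synchronise, and
    [cover_meet] shows that their meets cover the original label. *)
Lemma sim_at_comm (R R1 R2 : term -> term -> Prop) p p' q q' α c r :
  sim_at R1 p p' -> sim_at R2 q q' ->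
  (forall s t s' t', R1 s s' -> R2 t t' -> R (Par s t) (Par s' t')) ->
  comm (step p) (step q) α c r ->
  cover (fun α' => exists2 r', comm (step p') (step q') α' c r' & R r r') α.
Proof.
move=> [Hp _] [Hq _] RPar [β [β' [a [b [s [t [/Hp h /Hq h' e -> ->]]]]]]].
apply: (cover_meet h h') => γ γ' [s' h1 r1] [t' h2 r2]; exists (Par s' t'); last exact: RPar.
by exists γ, γ', a, b, s', t'.
Qed.

Lemma bis_Par p p' q q' : bis p p' -> bis q q' -> bis (Par p q) (Par p' q').
Proof.
move=> pp' qq'.
apply: (@bis_coind_sym (fun r r' => exists p q p' q',
  [/\ r = Par p q, r' = Par p' q', bis p p' & bis q q'])).
- by exists p, q, p', q'.
- move=> r r' [p1 [q1 [p2 [q2 [-> -> h h']]]]].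
  by exists p2, q2, p1, q1; split=> //; exact: bis_sym.
move=> r r' {p p' q q' pp' qq'} [p [q [p' [q' [-> -> pp' qq']]]]].
have /= [Hp Hp'] := bis_sim pp'; have /= [Hq Hq'] := bis_sim qq'; split.
  move=> α a s /= [[t /Hp h ->]|[t /Hq h ->]|h].
  - apply: cover_sub h _ => α' [t' ? ?]; exists (Par t' q').
      by constructor 1; exists t'.
    by left; exists t, q, t', q'.
  - apply: cover_sub h _ => α' [t' ? ?]; exists (Par p' t').
      by constructor 2; exists t'.
    by left; exists p, t, p', t'.
  - have := sim_at_comm (bis_sim pp') (bis_sim qq') _ h.
    move=> /(_ (fun r r' => exists p q p' q',
      [/\ r = Par p q, r' = Par p' q', bis p p' & bis q q'])) c.
    apply: cover_sub (c _) _; first by move=> s1 t1 s2 t2 ? ?; exists s1, t1, s2, t2.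
    by move=> α' [r1 ? ?]; exists r1; [constructor 3|left].
move=> α /= [β [β' [/Hp' h /Hq' h' ->]]]; apply: (cover_meet h h') => γ γ' ? ?.
by exists γ, γ'.
Qed.

(** After its first step a merge has become a parallel composition, so congruence of [Par] takes
    over and no coinduction is required. *)
Lemma bis_Lmerge p p' q q' : bis p p' -> bis q q' -> bis (Lmerge p q) (Lmerge p' q').
Proof.
have H p1 p1' q1 q1' : bis p1 p1' -> bis q1 q1' ->
    sim_at bis (Lmerge p1 q1) (Lmerge p1' q1').
  move=> /bis_sim[Hs _] qq'; split=> // α a _ /= [t /Hs h ->].
  apply: cover_sub h _ => α' [t' ? ?]; exists (Par t' q1'); first by exists t'.
  exact: bis_Par.
by move=> h h'; apply: bis_intro; apply: H => //; exact: bis_sym.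
Qed.

Lemma bis_Cmerge p p' q q' : bis p p' -> bis q q' -> bis (Cmerge p q) (Cmerge p' q').
Proof.
have H p1 p1' q1 q1' : bis p1 p1' -> bis q1 q1' ->
    sim_at bis (Cmerge p1 q1) (Cmerge p1' q1').
  move=> h h'; split=> // α a r /=; apply: (sim_at_comm (bis_sim h) (bis_sim h')).
  by move=> *; exact: bis_Par.
by move=> h h'; apply: bis_intro; apply: H => //; exact: bis_sym.
Qed.

Lemma bis_Seq p p' q q' : bis p p' -> bis q q' -> bis (Seq p q) (Seq p' q').
Proof.
move=> pp' qq'.
apply: (@bis_coind_sym (fun r r' => exists p q p' q',
  [/\ r = Seq p q, r' = Seq p' q', bis p p' & bis q q'])).
- by exists p, q, p', q'.
- move=> r r' [p1 [q1 [p2 [q2 [-> -> h h']]]]].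
  by exists p2, q2, p1, q1; split=> //; exact: bis_sym.
move=> r r' {p p' q q' pp' qq'} [p [q [p' [q' [-> -> pp' qq']]]]].
have /= [Hp Hp'] := bis_sim pp'; have /= [Hq Hq'] := bis_sim qq'; split.
  move=> α a s /= [[t /Hp h ->]|[β [β' [/Hp' h /Hq h' ->]]]].
  - apply: cover_sub h _ => α' [t' ? ?]; exists (Seq t' q').
      by left; exists t'.
    by left; exists t, q, t', q'.
  - apply: (cover_meet h h') => γ γ' ? [s' ? ?]; exists s'; last by right.
    by right; exists γ, γ'.
move=> α /= [β [β' [/Hp' h /Hq' h' ->]]]; apply: (cover_meet h h') => γ γ' ? ?.
by exists γ, γ'.
Qed.

Lemma bis_Encap H p p' : bis p p' -> bis (Encap H p) (Encap H p').
Proof.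
move=> pp'.
apply: (@bis_coind_sym (fun r r' => exists p p',
  [/\ r = Encap H p, r' = Encap H p' & bis p p'])).
- by exists p, p'.
- by move=> r r' [p1 [p2 [-> -> h]]]; exists p2, p1; split=> //; exact: bis_sym.
move=> r r' {p p' pp'} [p [p' [-> -> pp']]].
have /= [Hp Hp'] := bis_sim pp'; split=> // α a _ /= [t /Hp h [-> aH]].
apply: cover_sub h _ => α' [t' ? ?]; exists (Encap H t'); first by exists t'.
by left; exists t, t'.
Qed.

(** ** Laws of bisimilarity *)

Ltac destruct_all := repeat match goal with
  | H : False |- _ => destruct H
  | H : _ \/ _ |- _ => destruct H
  | H : [\/ _, _ | _] |- _ => destruct H
  | H : _ /\ _ |- _ => destruct H
  | H : [/\ _, _ & _] |- _ => destruct H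
  | H : [/\ _, _, _, _ & _] |- _ => destruct H
  | H : ex _ |- _ => destruct H
  | H : ex2 _ _ |- _ => destruct H
  end.

(** Settles laws whose two sides have literally the same labelled steps and the same residuals; laws
    that rearrange labels by Boolean identities are treated by hand. *)
Ltac ext := by apply: bis_ext => [? ? ?|?] /=; rewrite ?/comm; split => ?;
  destruct_all; subst; eauto 15 using And3, And5, ex_intro2.

Lemma bis_A1 p q : bis (Alt p q) (Alt q p). Proof. ext. Qed.
Lemma bis_A2 p q r : bis (Alt (Alt p q) r) (Alt p (Alt q r)). Proof. ext. Qed.
Lemma bis_A3 p : bis (Alt p p) p. Proof. ext. Qed.
Lemma bis_A4 p q r : bis (Seq (Alt p q) r) (Alt (Seq p r) (Seq q r)).
Proof. ext. Qed.
Lemma bis_A6 p : bis (Alt p Dlt) p. Proof. ext. Qed.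
Lemma bis_A7 p : bis (Seq Dlt p) Dlt. Proof. ext. Qed.
Lemma bis_TM2 p : bis (Lmerge Eps p) Dlt. Proof. ext. Qed.
Lemma bis_CM4 p q r : bis (Lmerge (Alt p q) r) (Alt (Lmerge p r) (Lmerge q r)).
Proof. ext. Qed.
Lemma bis_TM5 p : bis (Cmerge Eps p) Dlt. Proof. ext. Qed.
Lemma bis_TM6 p : bis (Cmerge p Eps) Dlt. Proof. ext. Qed.
Lemma bis_CM8 p q r : bis (Cmerge (Alt p q) r) (Alt (Cmerge p r) (Cmerge q r)).
Proof. ext. Qed.
Lemma bis_CM9 p q r : bis (Cmerge p (Alt q r)) (Alt (Cmerge p q) (Cmerge p r)).
Proof. ext. Qed.
Lemma bis_D0 H : bis (Encap H Eps) Eps. Proof. ext. Qed.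
Lemma bis_D3 H p q : bis (Encap H (Alt p q)) (Alt (Encap H p) (Encap H q)).
Proof. ext. Qed.
Lemma bis_GC3 φ : bis (Guard φ Dlt) Dlt. Proof. ext. Qed.
Lemma bis_GC4 φ p q : bis (Guard φ (Alt p q)) (Alt (Guard φ p) (Guard φ q)).
Proof. ext. Qed.
Lemma bis_GC8 φ p q : bis (Lmerge (Guard φ p) q) (Guard φ (Lmerge p q)).
Proof. ext. Qed.
Lemma bis_GC11 φ H p : bis (Encap H (Guard φ p)) (Guard φ (Encap H p)).
Proof. ext. Qed.

(** Steps are matched one to one with equal labels. Ignoring [\bot] is what lets a term, which keeps
    empty meets, be compared with a system, which drops them. *)
Lemma bis_coind_nonbot (R : term -> term -> Prop) p q : R p q ->
  (forall p q, R p q -> [/\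
    forall α a p', α <> \bot%O -> step p α a p' ->
      exists2 q', step q α a q' & R p' q' \/ bis p' q',
    forall α a q', α <> \bot%O -> step q α a q' ->
      exists2 p', step p α a p' & R p' q' \/ bis p' q' &
    forall α, α <> \bot%O -> (term_tm p α <-> term_tm q α)]) ->
  bis p q.
Proof.
move=> Rpq RB; apply: bis_coind Rpq _ => p1 q1 /RB[H1 H2 Ht].
split; split=> [α a s h|α h]; apply: cover_nonbot => nz.
- by have [s' ? ?] := H1 _ _ _ nz h; apply: cover_id; exists s'.
- by apply: cover_id; apply/(Ht _ nz).
- by have [s' ? ?] := H2 _ _ _ nz h; apply: cover_id; exists s'.
- by apply: cover_id; apply/(Ht _ nz).
Qed.

Lemma bis_coind_exact (R : term -> term -> Prop) p q : R p q ->
  (forall p q, R p q -> [/\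
    forall α a p', step p α a p' -> exists2 q', step q α a q' & R p' q' \/ bis p' q',
    forall α a q', step q α a q' -> exists2 p', step p α a p' & R p' q' \/ bis p' q' &
    forall α, term_tm p α <-> term_tm q α]) ->
  bis p q.
Proof.
move=> Rpq RB; apply: bis_coind_nonbot Rpq _ => p1 q1 /RB[H1 H2 Ht].
by split=> [α a s _ /H1|α a s _ /H2|α _].
Qed.

Lemma bis_match_nonbot p q :
  (forall α a p', α <> \bot%O -> step p α a p' -> exists2 q', step q α a q' & bis p' q') ->
  (forall α a q', α <> \bot%O -> step q α a q' -> exists2 p', step p α a p' & bis p' q') ->
  (forall α, α <> \bot%O -> (term_tm p α <-> term_tm q α)) -> bis p q.
Proof.
move=> H1 H2 Ht; apply: (@bis_coind_nonbot (fun p' q' => p' = p /\ q' = q)) => //.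
move=> _ _ [-> ->]; split=> // α a s nz; [move/(H1 _ _ _ nz)|move/(H2 _ _ _ nz)];
  by move=> [s' ? ?]; exists s' => //; right.
Qed.

Lemma bis_match p q :
  (forall α a p', step p α a p' -> exists2 q', step q α a q' & bis p' q') ->
  (forall α a q', step q α a q' -> exists2 p', step p α a p' & bis p' q') ->
  (forall α, term_tm p α <-> term_tm q α) -> bis p q.
Proof.
by move=> H1 H2 Ht; apply: bis_match_nonbot => [α a s _ /H1|α a s _ /H2|α _].
Qed.

(** The bracketing differs only while [p] is running. Once control leaves [p] the residuals
    coincide, and the labels agree by associativity of the meet. *)
Lemma bis_A5 p q r : bis (Seq (Seq p q) r) (Seq p (Seq q r)).
Proof.
apply: (@bis_coind_exact (fun s t => exists p q r,
  s = Seq (Seq p q) r /\ t = Seq p (Seq q r))); first by exists p, q, r.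
move=> _ _ {p q r} [p [q [r [-> ->]]]]; split=> [α a s /=|α a s /=|α /=].
- move=> [[x [[p' h ->]|[β [β' [h h' ->]]]] ->]|[_ [β' [[γ [γ' [h h' ->]]] h1 ->]]]].
  + by exists (Seq p' (Seq q r)); [left; exists p'|left; exists p', q, r].
  + exists (Seq x r); last by right; exact: bis_refl.
    by right; exists β, β'; split=> //; left; exists x.
  + exists s; last by right; exact: bis_refl.
    right; exists γ, (γ' `&` β')%O; split=> //; last by rewrite meetA.
    by right; exists γ', β'.
- move=> [[p' h ->]|[β [x [h [[q' h' ->]|[γ [γ' [h1 h2 ->]]]] ->]]]].
  + exists (Seq (Seq p' q) r); last by left; exists p', q, r.
    by left; exists (Seq p' q) => //; left; exists p'.
  + eexists; last by right; exact: bis_refl.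
    by left; exists q' => //; right; exists β, x.
  + exists s; last by right; exact: bis_refl.
    right; exists (β `&` γ)%O, γ'; split=> //; last by rewrite meetA.
    by exists β, γ.
- split=> [[_ [β' [[γ [γ' [h h' ->]]] h1 ->]]]|[β [_ [h [γ [γ' [h1 h2 ->]]] ->]]]].
    by exists γ, (γ' `&` β')%O; split=> //; [exists γ', β'|rewrite meetA].
  by exists (β `&` γ)%O, γ'; split=> //; [exists β, γ|rewrite meetA].
Qed.

Lemma bis_A8 p : bis (Seq p Eps) p.
Proof.
apply: (@bis_coind_exact (fun s t => s = Seq t Eps)) => // _ p1 ->.
split=> [α a s /=|α a s /= h|α /=].
- by move=> [[p' h ->]|[β [β' []]]] //; exists p' => //; left.
- by exists (Seq s Eps); left=> //; exists s.
- split=> [[β [_ [h -> ->]]]|h]; first by rewrite meetx1.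
  by exists α, \top%O; split=> //; rewrite meetx1.
Qed.

Lemma bis_A9 p : bis (Seq Eps p) p.
Proof.
apply: bis_ext => [α a r|α] /=; split.
- by move=> [[? []]|[_ [β [-> h ->]]]]; rewrite meet1x.
- by move=> h; right; exists \top%O, α; split=> //; rewrite meet1x.
- by move=> [_ [β [-> h ->]]]; rewrite meet1x.
- by move=> h; exists \top%O, α; split=> //; rewrite meet1x.
Qed.

Lemma bis_D4 H p q : bis (Encap H (Seq p q)) (Seq (Encap H p) (Encap H q)).
Proof.
apply: (@bis_coind_exact (fun s t => exists p,
  s = Encap H (Seq p q) /\ t = Seq (Encap H p) (Encap H q))); first by exists p.
move=> _ _ {p} [p [-> ->]]; split=> // α a s /=.
- move=> [x [[p' h ->]|[β [β' [h h' ->]]]] [-> aH]].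
  + exists (Seq (Encap H p') (Encap H q)); last by left; exists p'.
    by left; exists (Encap H p') => //; exists p'.
  + exists (Encap H x); last by right; exact: bis_refl.
    by right; exists β, β'; split=> //; exists x.
- move=> [[_ [p' h [-> aH]] ->]|[β [β' [h [q' h' [-> aH]] ->]]]].
  + exists (Encap H (Seq p' q)); last by left; exists p'.
    by exists (Seq p' q) => //; left; exists p'.
  + exists (Encap H q'); last by right; exact: bis_refl.
    by exists q' => //; right; exists β, β'.
Qed.

Lemma bis_GC1 p : bis (Guard \top%O p) p.
Proof.
apply: bis_ext => [α a r|α] /=; split=> [[β h ->]|h]; rewrite ?meet1x //;
  by exists α; rewrite ?meet1x.
Qed.

Lemma bis_GC2 p : bis (Guard \bot%O p) Dlt.
Proof.
by apply: bis_sub; split=> //= [_ a r|_] [β _ ->] u _; rewrite meet0x le0x.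
Qed.

Lemma bis_GC5 φ p q : bis (Guard φ (Seq p q)) (Seq (Guard φ p) q).
Proof.
apply: bis_ext => [α a r|α] /=; split.
- move=> [x [[p' h ->]|[β [β' [h h' ->]]]] ->].
    by left; exists p' => //; exists x.
  by right; exists (φ `&` β)%O, β'; split=> //; [exists β|rewrite meetA].
- move=> [[p' [β h ->] ->]|[_ [β' [[β h ->] h' ->]]]].
    by exists β => //; left; exists p'.
  by exists (β `&` β')%O; [right; exists β, β'|rewrite meetA].
- move=> [_ [β [β' [h h' ->]]] ->]; exists (φ `&` β)%O, β'.
  by split=> //; [exists β|rewrite meetA].
- move=> [_ [β' [[β h ->] h' ->]]]; exists (β `&` β')%O; last by rewrite meetA.
  by exists β, β'.
Qed.

Lemma bis_GC6 φ ψ p : bis (Guard φ (Guard ψ p)) (Guard (φ `&` ψ)%O p).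
Proof.
apply: bis_ext => [α a r|α] /=; split=> [[_ [β h ->] ->]|[β h ->]];
  try by exists β; rewrite ?meetA.
all: by exists (ψ `&` β)%O; rewrite ?meetA //; exists β.
Qed.

(** The law for which splitting is designed: one step on the left is answered by two on the right,
    whose labels join to the original one by distributivity although neither need dominate it
    alone. *)
Lemma bis_GC7 φ ψ p : bis (Guard (φ `|` ψ)%O p) (Alt (Guard φ p) (Guard ψ p)).
Proof.
apply: bis_sub; split=> /= [α a r|α].
- move=> [β h ->] u hu; rewrite meetUl leUx.
  by apply/andP; split; apply: hu; [left|right]; exists β.
- move=> [β h ->] u hu; rewrite meetUl leUx.
  by apply/andP; split; apply: hu; [left|right]; exists β.
- move=> [[β h ->]|[β h ->]]; (apply: cover_le; first by exists β; eauto);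
  by rewrite meetUl ?leUl ?leUr.
- move=> [[β h ->]|[β h ->]]; (apply: cover_le; first by exists β; eauto);
  by rewrite meetUl ?leUl ?leUr.
Qed.

Lemma bis_GC9 φ p q : bis (Cmerge (Guard φ p) q) (Guard φ (Cmerge p q)).
Proof.
apply: bis_ext => [α a r|α] /=; last by split=> // -[].
split.
- move=> [_ [β' [b [c [s [t [[β h ->] h' e -> ->]]]]]]].
  exists (β `&` β')%O; last by rewrite meetA.
  by exists β, β', b, c, s, t.
- move=> [_ [β [β' [b [c [s [t [h h' e -> ->]]]]]]] ->].
  by exists (φ `&` β)%O, β', b, c, s, t; split=> //; [exists β|rewrite meetA].
Qed.

Lemma bis_GC10 φ p q : bis (Cmerge p (Guard φ q)) (Guard φ (Cmerge p q)).
Proof.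
apply: bis_ext => [α a r|α] /=; last by split=> // -[].
split.
- move=> [β [_ [b [c [s [t [h [β' h' ->] e -> ->]]]]]]].
  exists (β `&` β')%O; last by rewrite meetCA.
  by exists β, β', b, c, s, t.
- move=> [_ [β [β' [b [c [s [t [h h' e -> ->]]]]]]] ->].
  by exists β, (φ `&` β')%O, b, c, s, t; split=> //; [exists β'|rewrite meetCA].
Qed.

Definition Cst (a : option A) : term := if a is Some b then Act b else Dlt.

(** An executed action leaves [Eps] behind, at different depths on the two sides; A9 erases it in
    both places. *)
Lemma bis_CM3 a p q : bis (Lmerge (Seq (Cst a) p) q) (Seq (Cst a) (Par p q)).
Proof.
have E : bis (Par (Seq Eps p) q) (Seq Eps (Par p q)).
  by apply: bis_trans (bis_sym (bis_A9 _)); apply: bis_Par (bis_A9 _) (bis_refl _).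
case: a => [a|]; last by ext.
apply: bis_match => [α b s|α b s|α] /=; last by split=> // -[? [? []]].
- move=> [_ [[_ [-> -> ->] ->]|[? [? []]]] //] ->.
  by exists (Seq Eps (Par p q)) => //; left; exists Eps.
- move=> [[_ [-> -> ->] ->]|[? [? []]]//].
  exists (Par (Seq Eps p) q) => //; exists (Seq Eps p) => //.
  by left; exists Eps.
Qed.

Lemma bis_D1 H a : ~~ in_encap H a -> bis (Encap H (Cst a)) (Cst a).
Proof.
case: a => [a /= aH|_]; last by ext.
apply: bis_match => //= α b s.
- by move=> [_ [-> -> ->] [-> _]]; exists Eps => //; exact: bis_D0.
- move=> [-> -> ->]; exists (Encap H Eps); last exact: bis_D0.
  by exists Eps.
Qed.

Lemma bis_D2 H a : in_encap H a -> bis (Encap H (Cst a)) Dlt.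
Proof.
case: a => //= a aH; apply: bis_ext => //= α b s.
by split=> // -[_ [_ -> _] [_]]; rewrite aH.
Qed.

(** * Laws that rest on properties of the communication function *)

Section Communication.
Hypothesis gammaC : commutative gamma.

Lemma comm_sym p q α c r : comm (step p) (step q) α c r ->
  exists s t, [/\ r = Par s t & comm (step q) (step p) α c (Par t s)].
Proof.
move=> [β [β' [a [b [s [t [h h' e -> ->]]]]]]]; exists s, t; split=> //.
by exists β', β, b, a, t, s; split=> //; [rewrite gammaC|rewrite meetC].
Qed.

(** Needed for CM1T: when [q] moves first, [Par p q] keeps the order of the components, whereas
    [Lmerge q p] continues with [q] in front. *)
Lemma bis_ParC p q : bis (Par p q) (Par q p).
Proof.
have tmC p1 q1 α : term_tm (Par p1 q1) α -> term_tm (Par q1 p1) α.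
  by move=> /= [β [β' [h h' ->]]]; exists β', β; split=> //; rewrite meetC.
have stC p1 q1 α a s : step (Par p1 q1) α a s ->
    exists p2 q2, s = Par p2 q2 /\ step (Par q1 p1) α a (Par q2 p2).
  move=> /= [[p' h ->]|[q' h ->]|/comm_sym[s1 [t1 [-> h]]]].
  - by exists p', q1; split=> //; constructor 2; exists p'.
  - by exists p1, q'; split=> //; constructor 1; exists q'.
  - by exists s1, t1; split=> //; constructor 3.
apply: (@bis_coind_exact (fun s t => exists p q, s = Par p q /\ t = Par q p)).
  by exists p, q.
move=> _ _ {p q} [p [q [-> ->]]]; split=> [α a s /stC|α a s /stC|α].
- by move=> [p' [q' [-> h]]]; exists (Par q' p') => //; left; exists p', q'.
- by move=> [p' [q' [-> h]]]; exists (Par q' p') => //; left; exists q', p'.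
- by split; exact: tmC.
Qed.

(** The three merges supply all steps but never terminate. The last summand supplies exactly the
    termination: encapsulating every action blocks all steps and keeps the termination
    conditions. *)
Lemma bis_CM1T p q : bis (Par p q)
  (Alt (Alt (Alt (Lmerge p q) (Lmerge q p)) (Cmerge p q))
       (Seq (Encap [set: A] p) (Encap [set: A] q))).
Proof.
apply: bis_match => [α a s|α a s|α] /=.
- move=> [[p' h ->]|[q' h ->]|h].
  + by exists (Par p' q); [left; left; left; exists p'|exact: bis_refl].
  + by exists (Par q' p); [left; left; right; exists q'|exact: bis_ParC].
  + by exists s; [left; right|exact: bis_refl].
- move=> [[[[p' h ->]|[q' h ->]]|h]|].
  + by exists (Par p' q); [constructor 1; exists p'|exact: bis_refl].
  + by exists (Par p q'); [constructor 2; exists q'|exact: bis_ParC].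
  + by exists s; [constructor 3|exact: bis_refl].
  + by move=> [[? [p' _ [_ +]] _]|[? [? [_ [q' _ [_ +]] _]]]]; rewrite inE.
- by split=> [|[[[]|]|]//]; right.
Qed.

Hypothesis gamma_delta : forall a, gamma None a = None.

(** Links the operator on processes with the function on actions, which turns C1 to C3 into
    properties of [gamma] and simplifies the right side of CM7. *)
Lemma bis_cst_comm a b : bis (Cmerge (Cst a) (Cst b)) (Cst (gamma a b)).
Proof.
have PE : bis (Par Eps Eps) Eps.
  apply: bis_ext => [α c s|α] /=; split=> //.
  - by move=> [[]|[]|[? [? [? [? [? [? []]]]]]]].
  - by move=> [_ [_ [-> -> ->]]]; rewrite meetx1.
  - by move=> ->; exists \top%O, \top%O; rewrite meetx1.
case: a b => [a|] [b|]; rewrite ?gamma_delta ?(gammaC _ None) ?gamma_delta; try by ext.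
case e : gamma => [c|] /=.
  apply: bis_match => //= α c' s.
  - move=> [_ [_ [_ [_ [_ [_ [[-> -> ->] [-> -> ->]]]]]]]].
    by rewrite e => -[->] -> ->; exists Eps => //; rewrite meetx1.
  - move=> [-> -> ->]; exists (Par Eps Eps) => //.
    by exists \top%O, \top%O, a, b, Eps, Eps; rewrite meetx1.
apply: bis_ext => //= α c' s; split=> //.
by move=> [_ [_ [_ [_ [_ [_ [[-> -> ->] [-> -> ->]]]]]]]]; rewrite e.
Qed.

Lemma bis_CM7 a b p q : bis (Cmerge (Seq (Cst a) p) (Seq (Cst b) q))
  (Seq (Cmerge (Cst a) (Cst b)) (Par p q)).
Proof.
apply: bis_trans (bis_sym (bis_Seq (bis_cst_comm a b) (bis_refl _))).
have E : bis (Par (Seq Eps p) (Seq Eps q)) (Seq Eps (Par p q)).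
  by apply: bis_trans (bis_sym (bis_A9 _)); apply: bis_Par (bis_A9 _) (bis_A9 _).
have stepA c α a' s r : step (Seq (Act c) r) α a' s <-> [/\ α = \top%O, a' = c & s = Seq Eps r].
  split=> /= [[[_ [-> -> ->] ->]|[? [? []]]]|[-> -> ->]] //.
  by left; exists Eps.
case: a b => [a|] [b|]; rewrite ?gamma_delta ?(gammaC _ None) ?gamma_delta; try by ext.
case e : gamma => [c|].
  apply: bis_match => [α c' s|α c' s|α].
  - move=> [_ [_ [_ [_ [_ [_ [/stepA[-> -> ->] /stepA[-> -> ->]]]]]]]].
    by rewrite e => -[->] -> ->; eexists; last exact: E; apply/stepA; rewrite meetx1.
  - move=> /stepA[-> -> ->]; eexists; last exact: E.
    exists \top%O, \top%O, a, b, (Seq Eps p), (Seq Eps q).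
    by split; rewrite ?meetx1 //; apply/stepA.
  - by split=> //= -[? [? []]].
apply: bis_ext => [α c' s|α]; split=> //.
- by move=> [_ [_ [_ [_ [_ [_ [/stepA[-> -> ->] /stepA[-> -> ->]]]]]]]]; rewrite e.
- by move=> [[]|[? [? []]]].
- by move=> [? [? []]].
Qed.
End Communication.

(** ** Operations on systems and operators on terms *)

Lemma bis_conn (T : cts) s : reach T s -> bis (St (conn T) s) (St T s).
Proof.
move=> rs; apply: (@bis_coind_exact (fun p q => exists s,
  [/\ p = St (conn T) s, q = St T s & reach T s])); first by exists s.
move=> _ _ {s rs} [s [-> -> rs]]; split=> [α a r /=|α a r /=|α /=].
- by move=> [s' [h _ rs'] ->]; exists (St T s'); [exists s'|left; exists s'].
- move=> [s' h ->]; have rs' := reach_tr rs h.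
  by exists (St (conn T) s'); [exists s'|left; exists s'].
- by split=> [[]|].
Qed.

Lemma bis_conn_ini (T : cts) : bis (St (conn T) (ini T)) (St T (ini T)).
Proof. by apply: bis_conn; exact: reach_ini. Qed.

(** Treats the copy of a component inside a compound system. Reflection is asked only at states of
    [T], because the freshly chosen initial state may be the image of a point outside [T]. *)
Lemma bis_embed (T T' : cts) (f : S -> S) : wf T ->
  (forall s α a r, st T s -> tr T' α a (f s) r -> exists2 s', r = f s' & tr T α a s s') ->
  (forall s α a s', tr T α a s s' -> tr T' α a (f s) (f s')) ->
  (forall s α, st T s -> tm T' α (f s) -> tm T α s) ->
  (forall s α, tm T α s -> tm T' α (f s)) ->
  forall s, st T s -> bis (St T' (f s)) (St T s).
Proof.
move=> w Htr' Htr Htm' Htm s Ts; apply: (@bis_coind_exact (fun p q => exists s,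
  [/\ p = St T' (f s), q = St T s & st T s])); first by exists s.
move=> _ _ {s Ts} [s [-> -> Ts]]; split=> [α a r /=|α a r /=|α /=].
- move=> [_ /(Htr' _ _ _ _ Ts)[s' -> h] ->]; have [_ _ Ts'] := wf_tr w h.
  by exists (St T s'); [exists s'|left; exists s'].
- move=> [s' h ->]; have [_ _ Ts'] := wf_tr w h.
  by exists (St T' (f s')); [exists (f s') => //; exact: Htr|left; exists s'].
- by split=> [/(Htm' _ _ Ts)|/Htm].
Qed.

Lemma bis_alt (T U : cts) : wf T -> wf U ->
  bis (St (alt_pre T U) (ini (alt_pre T U))) (Alt (St T (ini T)) (St U (ini U))).
Proof.
move=> w1 w2.
have EL s : st T s -> bis (St (alt_pre T U) (inL s)) (St T s).
  move: s; apply: bis_embed => // [s α a r|s α a s'|s α|s α].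
  - exact: alt_trL.
  - exact: alt_in1.
  - exact: alt_tmL.
  - exact: alt_tm_in1.
have ER s : st U s -> bis (St (alt_pre T U) (inR s)) (St U s).
  move: s; apply: bis_embed => // [s α a r|s α a s'|s α|s α].
  - exact: alt_trR.
  - exact: alt_in2.
  - exact: alt_tmR.
  - exact: alt_tm_in2.
apply: bis_match => [α a r [s /(alt_tr0 w1 w2)h ->]|α a r /=|α /=].
- case: h => [[x -> h]|[x -> h]]; have := wf_tr _ h => /(_ ltac:(done))[_ _ Tx].
  + by exists (St T x); [left; exists x|exact: EL].
  + by exists (St U x); [right; exists x|exact: ER].
- move=> [[x h ->]|[x h ->]]; have := wf_tr _ h => /(_ ltac:(done))[_ _ Tx].
  + exists (St (alt_pre T U) (inL x)); last exact: EL.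
    by exists (inL x) => //; exact: alt_ini1.
  + exists (St (alt_pre T U) (inR x)); last exact: ER.
    by exists (inR x) => //; exact: alt_ini2.
- split=> [/(alt_tm0 w1 w2)//|[h|h]]; [exact: alt_tm_ini1|exact: alt_tm_ini2].
Qed.

Lemma bis_seq (T U : cts) : wf T -> wf U ->
  bis (St (seq_pre T U) (ini (seq_pre T U))) (Seq (St T (ini T)) (St U (ini U))).
Proof.
move=> w1 w2.
have ER s : st U s -> bis (St (seq_pre T U) (inR s)) (St U s).
  move: s; apply: bis_embed => // [s α a r _|s α a s'|s α _|s α].
  - exact: seq_trR.
  - exact: seq_in2.
  - exact: seq_tmR.
  - exact: seq_tm_in2.
apply: (@bis_coind_nonbot (fun p q => exists s,
  p = St (seq_pre T U) (inL s) /\ q = Seq (St T s) (St U (ini U)))).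
  by exists (ini T).
move=> _ _ [s [-> ->]]; split=> [α a r _ [s1 /seq_trL h ->]|α a r nz /=|α nz /=].
- case: h => [[x -> h]|[β [β' [x [-> -> h h']]]]].
    exists (Seq (St T x) (St U (ini U))); last by left; exists x.
    by left; exists (St T x) => //; exists x.
  have [_ _ Ux] := wf_tr w2 h'.
  exists (St U x); last by right; exact: ER.
  by right; exists β, β'; split=> //; exists x.
- move=> [[_ [x h ->] ->]|[β [β' [h [x h' ->] e]]]].
    exists (St (seq_pre T U) (inL x)); last by left; exists x.
    by exists (inL x) => //; exact: seq_in1.
  have [_ _ Ux] := wf_tr w2 h'; rewrite e in nz *.
  exists (St (seq_pre T U) (inR x)); last by right; exact: ER.
  by exists (inR x) => //; exact: seq_pass.
- split=> [/seq_tmL[β [β' [-> h h']]]|[β [β' [h h' e]]]]; first by exists β, β'.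
  by rewrite e in nz *; exact: seq_tm_pass.
Qed.

Lemma bis_guard φ (T : cts) : wf T ->
  bis (St (guard_pre φ T) (ini (guard_pre φ T))) (Guard φ (St T (ini T))).
Proof.
move=> w.
have EL s : st T s -> bis (St (guard_pre φ T) (inL s)) (St T s).
  move: s; apply: bis_embed => // [s α a r|s α a s'|s α|s α].
  - exact: guard_trL.
  - exact: guard_in.
  - exact: guard_tmL.
  - exact: guard_tm_in.
apply: bis_match_nonbot => [α a r _ [s /(guard_tr0 w)h ->]|α a r nz /=|α nz /=].
- have [β [x [-> -> {}h]]] := h; have [_ _ Tx] := wf_tr w h.
  by exists (St T x); [exists β => //; exists x|exact: EL].
- move=> [β [x h ->] e]; have [_ _ Tx] := wf_tr w h; rewrite e in nz *.
  exists (St (guard_pre φ T) (inL x)); last exact: EL.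
  by exists (inL x) => //; exact: guard_ini.
- split=> [/(guard_tm0 w)[β -> h]|[β h e]]; first by exists β.
  by rewrite e in nz *; exact: guard_tm_ini.
Qed.

Lemma sync_comm (T U : cts) α c s t s' t' : sync gamma T U α c s t s' t' ->
  comm (step (St T s)) (step (St U t)) α c (Par (St T s') (St U t')).
Proof.
move=> [β β' a b h h' e -> _].
by exists β, β', a, b, (St T s'), (St U t'); split=> //; [exists s'|exists t'].
Qed.

Lemma comm_sync (T U : cts) α c s t r : α <> \bot%O ->
  comm (step (St T s)) (step (St U t)) α c r ->
  exists s' t', r = Par (St T s') (St U t') /\ sync gamma T U α c s t s' t'.
Proof.
move=> nz [β [β' [a [b [_ [_ [[s' h ->] [t' h' ->] e eα ->]]]]]]].
by exists s', t'; split=> //; exists β β' a b.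
Qed.

(** [V] is left open so that one argument covers the parallel composition and the part of both merge
    systems that lies behind their fresh initial state. *)
Lemma bis_par_inner (T U V : cts) : wf T -> wf U ->
  (forall s t, st T s -> st U t -> forall α a r,
     tr V α a (pr s t) r <-> par_tr gamma T U α a (pr s t) r) ->
  tm V = par_tm T U ->
  forall s t, st T s -> st U t -> bis (St V (pr s t)) (Par (St T s) (St U t)).
Proof.
move=> w1 w2 VE Vtm s t Ts Ut; apply: (@bis_coind_nonbot (fun p q => exists s t,
  [/\ p = St V (pr s t), q = Par (St T s) (St U t), st T s & st U t])).
  by exists s, t.
move=> _ _ {s t Ts Ut} [s [t [-> -> Ts Ut]]].
split=> [α a r nz [s' /(VE _ _ Ts Ut)/par_trE h ->]|α a r nz|α nz /=].
- case: h => [[x -> h]|[x -> h]|[x [y [-> h]]]].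
  + have [_ _ Tx] := wf_tr w1 h; exists (Par (St T x) (St U t)); last by left; exists x, t.
    by constructor 1; exists (St T x) => //; exists x.
  + have [_ _ Ux] := wf_tr w2 h; exists (Par (St T s) (St U x)); last by left; exists s, x.
    by constructor 2; exists (St U x) => //; exists x.
  + have [_ _ _ Tx Uy] := sync_st w1 w2 h.
    exists (Par (St T x) (St U y)); last by left; exists x, y.
    by constructor 3; exact: sync_comm.
- move=> [[_ [x h ->] ->]|[_ [x h ->] ->]|/(comm_sync nz)[x [y [-> h]]]].
  + have [_ _ Tx] := wf_tr w1 h; exists (St V (pr x t)); last by left; exists x, t.
    by exists (pr x t) => //; apply/VE => //; exact: par_left.
  + have [_ _ Ux] := wf_tr w2 h; exists (St V (pr s x)); last by left; exists s, x.
    by exists (pr s x) => //; apply/VE => //; exact: par_right.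
  + have [_ _ _ Tx Uy] := sync_st w1 w2 h.
    exists (St V (pr x y)); last by left; exists x, y.
    by exists (pr x y) => //; apply/VE => //; exact: par_sync.
- rewrite Vtm; split=> [/par_tmE[β [β' [-> h h']]]|[β [β' [h h' e]]]]; first by exists β, β'.
  by rewrite e in nz *; exact: Par_tm.
Qed.

Lemma bis_par (T U : cts) : wf T -> wf U ->
  bis (St (par_cts gamma T U) (ini (par_cts gamma T U))) (Par (St T (ini T)) (St U (ini U))).
Proof. by move=> w1 w2; apply: bis_par_inner => //; exact: wf_ini. Qed.

Lemma bis_lmerge (T U : cts) : wf T -> wf U ->
  bis (St (lmerge_pre gamma T U) (ini (lmerge_pre gamma T U)))
      (Lmerge (St T (ini T)) (St U (ini U))).
Proof.
move=> w1 w2; have Ui := wf_ini w2.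
have E s : st T s ->
    bis (St (lmerge_pre gamma T U) (pr s (ini U))) (Par (St T s) (St U (ini U))).
  move=> Ts; apply: bis_par_inner => // {Ts}s t Ts Ut α a r.
  by split=> [/(lmerge_trE w1 w2 Ts Ut)|/lmerge_in].
apply: bis_match => [α a r [s /(lmerge_tr0 w1 w2)h ->]|α a r /=|α].
- have [x -> {}h] := h; have [_ _ Tx] := wf_tr w1 h.
  exists (Par (St T x) (St U (ini U))); last exact: E.
  by exists (St T x) => //; exists x.
- move=> [_ [x h ->] ->]; have [_ _ Tx] := wf_tr w1 h.
  exists (St (lmerge_pre gamma T U) (pr x (ini U))); last exact: E.
  by exists (pr x (ini U)) => //; exact: lmerge_ini.
- by split=> // /(par_tm0 w1 w2).
Qed.

Lemma bis_cmerge (T U : cts) : wf T -> wf U ->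
  bis (St (cmerge_pre gamma T U) (ini (cmerge_pre gamma T U)))
      (Cmerge (St T (ini T)) (St U (ini U))).
Proof.
move=> w1 w2.
have E s t : st T s -> st U t ->
    bis (St (cmerge_pre gamma T U) (pr s t)) (Par (St T s) (St U t)).
  move=> Ts Ut; apply: bis_par_inner => // {Ts}s {Ut}t Ts Ut α a r.
  by split=> [/(cmerge_trE w1 w2 Ts Ut)|/cmerge_in].
apply: bis_match_nonbot => [α a r _ [s /(cmerge_tr0 w1 w2)h ->]|α a r nz|α _].
- have [x [y [-> {}h]]] := h; have [_ _ _ Tx Uy] := sync_st w1 w2 h.
  by exists (Par (St T x) (St U y)); [exact: sync_comm|exact: E].
- move=> /(comm_sync nz)[x [y [-> h]]]; have [_ _ _ Tx Uy] := sync_st w1 w2 h.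
  exists (St (cmerge_pre gamma T U) (pr x y)); last exact: E.
  by exists (pr x y) => //; exact: cmerge_ini.
- by split=> // /(par_tm0 w1 w2).
Qed.

Lemma bis_encap H (T : cts) s : bis (St (encap_pre H T) s) (Encap H (St T s)).
Proof.
apply: (@bis_coind_exact (fun p q => exists s,
  p = St (encap_pre H T) s /\ q = Encap H (St T s))); first by exists s.
move=> _ _ {s} [s [-> ->]]; split=> [α a r /= [s' [h aH] ->]|α a r /= |α //].
- exists (Encap H (St T s')); last by left; exists s'.
  by exists (St T s') => //; exists s'.
- move=> [_ [s' h ->] [-> aH]].
  exists (St (encap_pre H T) s'); last by left; exists s'.
  by exists s'.
Qed.

Lemma bis_delta : bis (St (delta_cts A B S) (ini (delta_cts A B S))) Dlt.
Proof. by apply: bis_ext => [α a r|α] //=; split=> // -[]. Qed.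

Lemma bis_eps : bis (St (eps_cts A B S) (ini (eps_cts A B S))) Eps.
Proof. by apply: bis_ext => [α a r|α] //=; split=> // -[]. Qed.

Lemma bis_act (Kinf : infinite_set [set: K]%classic) a :
  bis (St (act_cts B S a) (ini (act_cts B S a))) (Act a).
Proof.
set s0 := ch [set: S]%classic; set s1 := ch (~` [set s0])%classic.
(* The universe of states is infinite because [K] is, so the complement of [s0] is nonempty and [ch]
   does select from it. *)
have s10 : s1 <> s0.
  have [x nx] := (proper_setTP _).1 (finite_proper Kinf (finite_set1 s0)).
  by apply: (@chP _ S (~` [set s0])%classic); exists x.
have E : bis (St (act_cts B S a) s1) Eps.
  apply: bis_ext => [α b r|α] /=; split=> //; last by case.
  by move=> [s' [_ _ /s10]].
apply: bis_match => [α b r /=|α b r /=|α] /=.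
- by move=> [_ [-> -> _ ->] ->]; exists Eps.
- by move=> [-> -> ->]; exists (St (act_cts B S a) s1) => //; exists s1.
- by split=> // -[_ /esym/s10].
Qed.

End Terms.

(** * Transfer from terms to the quotient model *)

Section Denotation.
Variables (A : finType) (gamma : option A -> option A -> option A).
Variables (K C : Type) (Kinf : infinite_set [set: K]%classic).
Variables (d : Order.disp_t) (B : ctbDistrLatticeType d) (gen : C -> B).
Variables (HB : free_kcomplete K gen) (S : state_universe K).
Local Notation M := (Mk gamma S Kinf HB).
Local Notation "p ~~ q" := (bis gamma p q) (at level 70).

Lemma split_bisim_bis (T U : Tk A B S) :
  split_bisim T U <-> St T (ini T) ~~ St U (ini U).
Proof.
split=> [/(split_bisimP HB)[R [_ Ri TU UT]]|TU].
  exists (fun p q => exists s t, [/\ p = St T s, q = St U t & R s t]).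
    by exists (ini T), (ini U).
  move=> _ _ [s [t [-> -> Rst]]]; have [H1 H2] := TU _ _ Rst; have [H3 H4] := UT _ _ Rst.
  split; split=> [α a p' /= [x h ->]|α h].
  - move=> u hu; apply: H1 (h) _ _ => α' y h1 h2.
    by apply: hu; exists (St U y); [exists y|exists x, y].
  - by move=> u; exact: H2.
  - move=> u hu; apply: H3 (h) _ _ => α' y h1 h2.
    by apply: hu; exists (St T y); [exists y|exists y, x].
  - by move=> u; exact: H4.
have H (V W : cts A B S) : simB V W (fun s t => St V s ~~ St W t).
  move=> s t /bis_sim[H1 H2]; split=> [α a s' h u hu|α h u]; last exact: H2.
  apply: (H1 α a (St V s')) => [|α' [_ [t' h1 ->] h2]]; first by exists s'.
  exact: hu h2.
(* Here the families of answers regain their size bound: [simBP] takes all matching transitions, and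
   there are few enough by the branching degree. *)
apply: (simBP HB (R := fun s t => St T s ~~ St U t)) => //; try exact: sys_wf.
by move=> s t /bis_sym/H[H1 H2]; split=> // α a s' /H1 h u hu;
  apply: h => α' t' h1 /bis_sym; exact: hu.
Qed.

Definition den (x : Proc M) (p : term A B S) : Prop := St (rep x) (ini (rep x)) ~~ p.

Lemma den_self (x : Proc M) : den x (St (rep x) (ini (rep x))).
Proof. exact: bis_refl. Qed.

(** The passage from laws on terms to equations in the model: elements denoting bisimilar terms have
    bisimilar representatives, hence are the same class. *)
Lemma den_inj (x y : Proc M) p q : den x p -> den y q -> p ~~ q -> x = y.
Proof.
move=> xp yq pq; rewrite -[x]reprK -[y]reprK; apply/cls_eq/split_bisim_bis.
exact: bis_trans xp (bis_trans pq (bis_sym yq)).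
Qed.

Lemma den_cls (T : Tk A B S) p : St T (ini T) ~~ p -> den (cls HB T : Proc M) p.
Proof. by apply: bis_trans; apply/split_bisim_bis; exact: rep_cls. Qed.

Lemma den_cst a : den (Defs.cst M a) (Cst B S a).
Proof.
case: a => [a|]; apply: den_cls; [exact: bis_act|exact: bis_delta].
Qed.

Lemma den_delta : den (delta M) (Dlt A B S).
Proof. by apply: den_cls; exact: bis_delta. Qed.

Lemma den_eps : den (eps M) (Eps A B S).
Proof. by apply: den_cls; exact: bis_eps. Qed.

Lemma den_alt x y p q : den x p -> den y q -> den (alt x y) (Alt p q).
Proof.
move=> xp yq; apply: den_cls; apply: bis_trans (bis_conn_ini _ _) _.
by apply: bis_trans (bis_alt _ _ _) (bis_Alt xp yq); exact: sys_wf.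
Qed.

Lemma den_seqc x y p q : den x p -> den y q -> den (seqc x y) (Seq p q).
Proof.
move=> xp yq; apply: den_cls; apply: bis_trans (bis_conn_ini _ _) _.
by apply: bis_trans (bis_seq _ _ _) (bis_Seq xp yq); exact: sys_wf.
Qed.

Lemma den_par x y p q : den x p -> den y q -> den (par x y) (Par p q).
Proof.
move=> xp yq; apply: den_cls.
by apply: bis_trans (bis_par _ _ _) (bis_Par xp yq); exact: sys_wf.
Qed.

Lemma den_lmerge x y p q : den x p -> den y q -> den (lmerge x y) (Lmerge p q).
Proof.
move=> xp yq; apply: den_cls; apply: bis_trans (bis_conn_ini _ _) _.
by apply: bis_trans (bis_lmerge _ _ _) (bis_Lmerge xp yq); exact: sys_wf.
Qed.

Lemma den_cmerge x y p q : den x p -> den y q -> den (cmerge x y) (Cmerge p q).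
Proof.
move=> xp yq; apply: den_cls; apply: bis_trans (bis_conn_ini _ _) _.
by apply: bis_trans (bis_cmerge _ _ _) (bis_Cmerge xp yq); exact: sys_wf.
Qed.

Lemma den_guard φ x p : den x p -> den (guard (φ : Cond M) x) (Guard φ p).
Proof.
move=> xp; apply: den_cls; apply: bis_trans (bis_conn_ini _ _) _.
by apply: bis_trans (bis_guard _ _ _) (bis_Guard φ xp); exact: sys_wf.
Qed.

Lemma den_encap H x p : den x p -> den (encap H x) (Encap H p).
Proof.
move=> xp; apply: den_cls; apply: bis_trans (bis_conn_ini _ _) _.
exact: bis_trans (bis_encap _ _ _ _) (bis_Encap H xp).
Qed.
End Denotation.

Ltac denote := repeat match goal with
  | |- den (Defs.cst _ _) _ => apply: den_cst
  | |- den (delta _) _ => apply: den_delta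
  | |- den (eps _) _ => apply: den_eps
  | |- den (alt _ _) _ => apply: den_alt
  | |- den (seqc _ _) _ => apply: den_seqc
  | |- den (par _ _) _ => apply: den_par
  | |- den (lmerge _ _) _ => apply: den_lmerge
  | |- den (cmerge _ _) _ => apply: den_cmerge
  | |- den (guard _ _) _ => apply: den_guard
  | |- den (encap _ _) _ => apply: den_encap
  | |- den _ _ => apply: den_self
  end.

Theorem theorem1 (A : finType) (gamma : option A -> option A -> option A)
    (gammaC : commutative gamma) (gammaA : associative gamma)
    (gamma_delta : forall a : option A, gamma None a = None)
    (C K : Type) (Kinf : infinite_set [set: K]%classic)
    (d : Order.disp_t) (B : ctbDistrLatticeType d) (gen : C -> B)
    (HB : free_kcomplete K gen) (S : state_universe K) :
  acpc_model (Mk gamma S Kinf HB).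
Proof.
have cc a b : bis gamma (Cmerge (Cst B S a) (Cst B S b)) (Cst B S (gamma a b)).
  exact: bis_cst_comm.
(* [denote] builds the two terms from the shape of the equation, with each variable read as the
   initial state of its representative. The Boolean axioms are not equations between processes, so
   [try] leaves them as they are. *)
split; intros; try (eapply den_inj; [by denote|by denote|]).
- exact: bis_A1.
- exact: bis_A2.
- exact: bis_A3.
- exact: bis_A4.
- exact: bis_A5.
- exact: bis_A6.
- exact: bis_A7.
- exact: bis_A8.
- exact: bis_A9.
- exact: bis_CM1T.
- exact: bis_TM2.
- exact: bis_CM3.
- exact: bis_CM4.
- exact: bis_TM5.
- exact: bis_TM6.
- exact: bis_CM7.
- exact: bis_CM8.
- exact: bis_CM9.
- by apply: bis_trans (cc _ _) _; rewrite gammaC; exact: bis_sym.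
- apply: bis_trans (bis_Cmerge (cc _ _) (bis_refl _ _)) _.
  apply: bis_trans (bis_sym (bis_Cmerge (bis_refl _ _) (cc _ _))).
  by apply: bis_trans (cc _ _) _; rewrite -gammaA; exact: bis_sym.
- by have := cc None a; rewrite gamma_delta.
- exact: bis_D0.
- exact: bis_D1.
- exact: bis_D2.
- exact: bis_D3.
- exact: bis_D4.
- exact: bis_GC1.
- exact: bis_GC2.
- exact: bis_GC3.
- exact: bis_GC4.
- exact: bis_GC5.
- exact: bis_GC6.
- exact: bis_GC7.
- exact: bis_GC8.
- exact: bis_GC9.
- exact: bis_GC10.
- exact: bis_GC11.
- exact: joinx0.
- exact: joinxC.
- exact: joinC.
- exact: joinIr.
- exact: meetx1.
- exact: meetxC.
- exact: meetC.
- exact: meetUr.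
Qed.
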